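(* Consider the transmission of arbitrarily correlated sources $S_1$ and $S_2$ over the discrete memoryless MARC with channel law $p(y,y_3|x_1,x_2,x_3)$, relay side information $W_3$ and receiver side information $W$, with joint law $p(s_1,s_2,w_3,w)$. Any achievable source-channel rate $\kappa$ must satisfy both of the following. (i) There is an input distribution $p(x_1,x_2,x_3)$ such that, with $(Y,Y_3)$ generated from $(X_1,X_2,X_3)$ through the channel, $$\begin{aligned} H(S_1|S_2,W) &\le \kappa I(X_1,X_3;Y|X_2),\\ H(S_2|S_1,W) &\le \kappa I(X_2,X_3;Y|X_1),\\ H(S_1,S_2|W) &\le \kappa I(X_1,X_2,X_3;Y). \end{aligned}$$ (ii) There is an input distribution of the form $p(v)\,p(x_1,x_2|v)\,p(x_3|v)$, with $V$ taking values in an alphabet $\mathcal V$ with $|\mathcal V|\le 4$, such that, with $(Y,Y_3)$ generated from $(X_1,X_2,X_3)$ through the channel (so that $V-(X_1,X_2,X_3)-(Y,Y_3)$ is a Markov chain), $$\begin{aligned} H(S_1|S_2,W,W_3) &\le \kappa I(X_1;Y,Y_3|X_2,V),\\ H(S_2|S_1,W,W_3) &\le \kappa I(X_2;Y,Y_3|X_1,V),\\ H(S_1,S_2|W,W_3) &\le \kappa I(X_1,X_2;Y,Y_3|V). \end{aligned}$$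
   Context: Sources and side information. $\{(S_{1,k},S_{2,k},W_k,W_{3,k})\}_{k\ge 1}$ are i.i.d. across $k$ with joint law $p(s_1,s_2,w,w_3)$ on a finite alphabet $\mathcal S_1\times\mathcal S_2\times\mathcal W\times\mathcal W_3$, known to all nodes. Transmitter $i$ ($i=1,2$) observes $S_i^m$, the relay observes side information $W_3^m$, the receiver (destination) observes side information $W^m$. Channel. The discrete memoryless multiple-access relay channel (MARC) has finite input alphabets $\mathcal X_1,\mathcal X_2,\mathcal X_3$ (transmitter 1, transmitter 2, relay), finite output alphabets $\mathcal Y$ (receiver), $\mathcal Y_3$ (relay), and is memoryless: for each $k=1,\dots,n$, the conditional law of $(Y_k,Y_{3,k})$ given all sources, side informations, inputs up to time $k$ and outputs up to time $k-1$ equals $p(y_k,y_{3,k}|x_{1,k},x_{2,k},x_{3,k})$. Codes. An $(m,n)$ source-channel code for the MARC consists of encoders $f_i^{(m,n)}:\mathcal S_i^m\to\mathcal X_i^n$, $i=1,2$; causal relay encoders with $x_{3,k}=f_{3,k}^{(m,n)}(y_{3,1}^{k-1},w_3^m)$, $1\le k\le n$; and a receiver decoder $g^{(m,n)}:\mathcal Y^n\times\mathcal W^m\to\mathcal S_1^m\times\mathcal S_2^m$ with output $(\hat S_1^m,\hat S_2^m)$. Its error probability is $P_e^{(m,n)}=\Pr\{(\hat S_1^m,\hat S_2^m)\ne(S_1^m,S_2^m)\}$. Achievability. A source-channel rate $\kappa$ is achievable if for every $\epsilon>0$ there is $m_0$ such that for all $m>m_0$, with $n=\lfloor\kappa m\rfloor$,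 there exists an $(m,n)$ code with $P_e^{(m,n)}<\epsilon$. *)

(* Defs.v *)
From HB Require Import structures.
From mathcomp Require Import all_boot all_order all_algebra.
From mathcomp Require Import reals exp.

Set Implicit Arguments.
Unset Strict Implicit.
Unset Printing Implicit Defensive.

Import Order.TTheory GRing.Theory Num.Theory.
Local Open Scope ring_scope.

Record fdist (R : realType) (T : finType) := FDist {
  pmf :> T -> R;
  pmf_ge0 : forall t, 0 <= pmf t;
  pmf_sum1 : \sum_t pmf t = 1 }.
Arguments fdist R T%_type_scope.

(* Information measures of random variables (functions on a finite sample
   space Omega) under a probability mass function P on Omega.  Logarithms are
   natural; as every inequality stated with these quantities is homogeneous in
   them, the base is immaterial.  Since ln 0 = 0 and x / 0 = 0, terms of zero
   probability contribute 0. *)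
Section information.
Variables (R : realType) (Omega : finType) (P : Omega -> R).

Definition prob (E : pred Omega) : R := \sum_(o | E o) P o.

Definition entropy (A : finType) (X : Omega -> A) : R :=
  - \sum_a prob (fun o => X o == a) * ln (prob (fun o => X o == a)).

Definition cond_entropy (A B : finType) (X : Omega -> A) (Y : Omega -> B) : R :=
  - \sum_a \sum_b
      prob (fun o => (X o == a) && (Y o == b)) *
      ln (prob (fun o => (X o == a) && (Y o == b)) / prob (fun o => Y o == b)).

Definition mutual_info (A B : finType) (X : Omega -> A) (Y : Omega -> B) : R :=
  entropy X - cond_entropy X Y.

Definition cond_mutual_info (A B C : finType)
    (X : Omega -> A) (Y : Omega -> B) (Z : Omega -> C) : R :=
  cond_entropy X Z - cond_entropy X (fun o => (Y o, Z o)).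

End information.

Section marc.
Variables (R : realType) (S1 S2 W W3 X1 X2 X3 Y Y3 : finType).

Definition marc_channel := X1 -> X2 -> X3 -> fdist R (Y * Y3).

(* A letter at time k (1 <= k <= n) has index k - 1 in 'I_n, so that the relay
   input of index k may depend on exactly k past outputs. *)
Record code (m n : nat) := Code {
  enc1 : {ffun 'I_m -> S1} -> {ffun 'I_n -> X1};
  enc2 : {ffun 'I_m -> S2} -> {ffun 'I_n -> X2};
  relay : forall k : 'I_n, {ffun 'I_k -> Y3} -> {ffun 'I_m -> W3} -> X3;
  dec : {ffun 'I_n -> Y} -> {ffun 'I_m -> W} ->
        {ffun 'I_m -> S1} * {ffun 'I_m -> S2} }.

Definition past (n : nat) (y : {ffun 'I_n -> Y3}) (k : 'I_n) :
    {ffun 'I_k -> Y3} :=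
  [ffun j : 'I_k => y (widen_ord (ltnW (ltn_ord k)) j)].

Definition code_space (m n : nat) : finType :=
  ({ffun 'I_m -> S1} * {ffun 'I_m -> S2} * {ffun 'I_m -> W} *
   {ffun 'I_m -> W3} * {ffun 'I_n -> Y} * {ffun 'I_n -> Y3})%type.

(* Joint law of sources, side informations and channel outputs: the chain rule
   over time, with i.i.d. sources, inputs produced by the code, and a
   memoryless channel. *)
Definition code_law (p : fdist R (S1 * S2 * W * W3)) (ch : marc_channel)
    (m n : nat) (c : code m n) : code_space m n -> R :=
  fun '(s1, s2, w, w3, y, y3) =>
    (\prod_(j < m) p (s1 j, s2 j, w j, w3 j)) *
    \prod_(k < n) ch (enc1 c s1 k) (enc2 c s2 k) (relay c (past y3 k) w3)
                     (y k, y3 k).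

Definition error_prob (p : fdist R (S1 * S2 * W * W3)) (ch : marc_channel)
    (m n : nat) (c : code m n) : R :=
  prob (code_law p ch c)
       (fun '(s1, s2, w, w3, y, y3) => dec c y w != (s1, s2)).

(* The floor is an integer, so no negative kappa is achievable. *)
Definition achievable (p : fdist R (S1 * S2 * W * W3)) (ch : marc_channel)
    (kappa : R) : Prop :=
  forall eps : R, 0 < eps -> exists m0 : nat, forall m : nat, (m0 < m)%N ->
    exists n : nat, n%:Z = Num.floor (kappa * m%:R) /\
    exists c : code m n, error_prob p ch c < eps.

Definition law_X (P : fdist R (X1 * X2 * X3)) (ch : marc_channel) :
    X1 * X2 * X3 * Y * Y3 -> R :=
  fun '(x1, x2, x3, y, y3) => P (x1, x2, x3) * ch x1 x2 x3 (y, y3).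

Definition law_VX (V : finType) (PV : fdist R V) (P12 : V -> fdist R (X1 * X2))
    (P3 : V -> fdist R X3) (ch : marc_channel) :
    V * X1 * X2 * X3 * Y * Y3 -> R :=
  fun '(v, x1, x2, x3, y, y3) =>
    PV v * P12 v (x1, x2) * P3 v x3 * ch x1 x2 x3 (y, y3).

End marc.

(* Main.v *)
Require Import Defs.
From HB Require Import structures.
From mathcomp Require Import all_boot all_order all_algebra.
From mathcomp Require Import reals exp.
From mathcomp Require Import boolp classical_sets topology normedtype derive.
From mathcomp Require Import ring lra.

(* With V_k = (Y3^{k-1}, W3^m), Fano's inequality and the chain rule bound each
   source entropy by a sum over channel uses of terms H(Y_k | D_k) - H(Y_k | G_k),
   where D_k is decided by the outputs before time k and the conditioning sources,
   while G_k determines the channel input; by memorylessness the second entropy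
   depends only on that input.  A uniform time index K turns the sum into a single
   conditional mutual information: for (i), K is dropped because conditioning
   reduces entropy, and for (ii), K becomes part of V.  Each quantity in (ii) is an
   average over V of a function of p(x1,x2|v) p(x3|v), so Caratheodory's theorem in
   dimension 3 leaves four values of V.  The bounds so far carry an error that is
   arbitrarily small; it disappears by continuity of entropy on the compact set of
   input distributions. *)

Set Implicit Arguments.
Unset Strict Implicit.
Unset Printing Implicit Defensive.

Import Order.TTheory GRing.Theory Num.Theory.
Import numFieldNormedType.Exports.
Local Open Scope ring_scope.

(** * Entropy on finite sample spaces *)

(** The two cuts differ in who knows the relay input. The receiver alone does not, so in (i) the
    relay input stays among the inputs that cross the cut. In (ii) the receiver is also given [Y3]
    and [W3]; then [V] is decided by what is already conditioned on, and it fixes the relay input,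
    so p(x3|v) can be a point mass and the product form holds for every code. The alphabet of this
    [V] grows with the block lengths, which leaves no fixed compact set for a limit over codes; the
    reduction to four values, one more than the number of bounds, is therefore made for each code
    before the limit is taken. The limit uses the coordinates of p(v), p(x1,x2|v) and p(x3|v) rather
    than those of the joint law, so that the product form survives it. A rate below 1 may give codes
    without any channel use, for which no time index can be drawn; they are treated apart. *)

Definition determines (T A B : Type) (X : T -> A) (Y : T -> B) : Prop :=
  forall o o', X o = X o' -> Y o = Y o'.

Ltac determine := let e := fresh in intros ? ? e; cbn in e |- *; congruence.

Section EntropyBasics.
Context {R : realType} {Omega : finType}.
Implicit Types (P : Omega -> R) (A B C D : finType).

(** The mass of the fibre of [X] through [o]. Entropies become expectations over the sample space of
    the logarithm of an atom, so variables with different codomains compare term by term. *)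
Definition atom P A (X : Omega -> A) (o : Omega) : R :=
  prob P (fun o' => X o' == X o).

Lemma entropyE P A (X : Omega -> A) :
  entropy P X = - \sum_o P o * ln (atom P X o).
Proof.
rewrite /entropy; congr (- _).
rewrite (partition_big X xpredT)//=; apply: eq_bigr => a _.
rewrite {1}/prob mulr_suml; apply: eq_bigr => o /eqP Xo.
by rewrite /atom Xo.
Qed.

Lemma ge_atom P A (X : Omega -> A) o : (forall o, 0 <= P o) -> P o <= atom P X o.
Proof.
move=> P0; rewrite /atom /prob (bigD1 o)//= lerDl.
by apply: sumr_ge0.
Qed.

Lemma atom_gt0 P A (X : Omega -> A) o : (forall o, 0 <= P o) ->
  0 < P o -> 0 < atom P X o.
Proof. by move=> P0 Po; apply: lt_le_trans Po (ge_atom _ _ _). Qed.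

Lemma atom_le P A B (X : Omega -> A) (Y : Omega -> B) o :
  (forall o, 0 <= P o) -> determines X Y -> atom P X o <= atom P Y o.
Proof.
move=> P0 XY; rewrite /atom /prob [leRHS](bigID (fun o' => X o' == X o))/=.
rewrite [X in _ <= X + _](eq_bigl (fun o' => X o' == X o)) ?lerDl ?sumr_ge0//.
by move=> o'; case: (X o' =P X o) => [e|_]; [rewrite (XY _ _ e) eqxx | rewrite andbF].
Qed.

(** The inequality ln u <= u - 1 at u = a / b, scaled by [x]. Summed over outcomes, the right side
    is a difference of total masses, which is Gibbs' inequality. *)
Lemma gibbs_term (x a b : R) : 0 < x -> 0 < a -> 0 < b ->
  x * (ln a - ln b) <= x * (a / b) - x.
Proof.
move=> x0 a0 b0; rewrite -{3}[x]mulr1 -mulrBr ler_pM2l// -ln_div ?posrE//.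
rewrite -{1}[a / b](subrK 1) addrC; apply: le_ln1Dx.
by rewrite ltrBDl subrr divr_gt0.
Qed.

Lemma entropy_le P A B (X : Omega -> A) (Y : Omega -> B) :
  (forall o, 0 <= P o) -> determines X Y -> entropy P Y <= entropy P X.
Proof.
move=> P0 XY; rewrite !entropyE lerN2; apply: ler_sum => o _.
have [Po|Po] := eqVneq (P o) 0; first by rewrite Po !mul0r.
have {}Po : 0 < P o by rewrite lt_neqAle eq_sym Po P0.
rewrite ler_pM2l// ler_ln ?posrE ?atom_gt0//.
exact: atom_le.
Qed.

Lemma entropy_eq P A B (X : Omega -> A) (Y : Omega -> B) :
  (forall o, 0 <= P o) -> determines X Y -> determines Y X ->
  entropy P X = entropy P Y.
Proof. by move=> P0 XY YX; apply: le_anti; rewrite !entropy_le. Qed.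

Lemma cond_entropyE P A B (X : Omega -> A) (Y : Omega -> B) :
  (forall o, 0 <= P o) ->
  cond_entropy P X Y = entropy P (fun o => (X o, Y o)) - entropy P Y.
Proof.
move=> P0; rewrite !entropyE opprK addrC /cond_entropy pair_big/=.
rewrite -opprB; congr (- _); rewrite -sumrB.
rewrite [RHS](partition_big (fun o => (X o, Y o)) xpredT)//=.
apply: eq_bigr => -[a b] _ /=; rewrite {1}/prob mulr_suml.
apply: eq_big => [o|o /andP[/eqP Xo /eqP Yo]]; first by rewrite -xpair_eqE.
have [Po|Po] := eqVneq (P o) 0; first by rewrite Po !mul0r subrr.
have {}Po : 0 < P o by rewrite lt_neqAle eq_sym Po P0.
rewrite -mulrBr -Xo -Yo.
have -> : prob P (fun o' => (X o' == X o) && (Y o' == Y o)) =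
          atom P (fun o => (X o, Y o)) o.
  by apply: eq_bigl => o'; rewrite xpair_eqE.
by rewrite ln_div ?posrE ?atom_gt0.
Qed.

(* Gibbs' inequality on the sample space against the mass function
   [P * atom X * atom Y / (atom (X, Y) * atom Z)].  Expanding [atom X o] and
   [atom Y o] as sums over [o1] and [o2] bounds its total: [o1] and [o2] lie in
   the same [Z]-fibre whenever some [o] contributes to the pair. *)
Lemma entropy_submodular P A B C
    (X : Omega -> A) (Y : Omega -> B) (Z : Omega -> C) :
  (forall o, 0 <= P o) -> determines X Z -> determines Y Z ->
  entropy P (fun o => (X o, Y o)) + entropy P Z <= entropy P X + entropy P Y.
Proof.
move=> P0 XZ YZ; rewrite -subr_le0 !entropyE.
set XY := fun o => (X o, Y o).
have pos o : P o != 0 -> 0 < P o by move=> h; rewrite lt_neqAle eq_sym h P0.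
have -> : - (\sum_o P o * ln (atom P XY o)) - \sum_o P o * ln (atom P Z o) -
    (- (\sum_o P o * ln (atom P X o)) - \sum_o P o * ln (atom P Y o)) =
    \sum_o P o * (ln (atom P X o * atom P Y o) - ln (atom P XY o * atom P Z o)).
  rewrite !opprD !opprK -!sumrN -!big_split /=; apply: eq_bigr => o _.
  have [->|/pos Po] := eqVneq (P o) 0; first by rewrite !mul0r oppr0 !addr0.
  by rewrite !lnM ?posrE ?atom_gt0//; ring.
pose r o := P o * (atom P X o * atom P Y o / (atom P XY o * atom P Z o)).
apply: (@le_trans _ _ (\sum_o (r o - P o))).
  apply: ler_sum => o _.
  have [Po|/pos Po] := eqVneq (P o) 0; first by rewrite /r Po !mul0r subrr.
  by apply: gibbs_term => //; rewrite mulr_gt0// atom_gt0.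
rewrite sumrB subr_le0.
have a0 A' (V : Omega -> A') o : 0 <= atom P V o.
  exact: le_trans (P0 _) (ge_atom _ _ P0).
have rE o : r o = \sum_(o1 | X o1 == X o) \sum_(o2 | Y o2 == Y o)
    P o1 * P o2 * (P o / (atom P XY o * atom P Z o)).
  rewrite (eq_bigr (fun o1 => P o1 *
      (atom P Y o * (P o / (atom P XY o * atom P Z o))))) => [|o1 _].
    by rewrite -mulr_suml -[\sum_(_ | _) _]/(atom P X o) /r; ring.
  by rewrite -mulr_suml -mulr_sumr -[\sum_(_ | _) _]/(atom P Y o); ring.
under eq_bigr do rewrite rE.
rewrite (exchange_big_dep xpredT)//=.
apply: ler_sum => o1 _.
rewrite (exchange_big_dep (fun o2 => Z o2 == Z o1))/=; last first.
  by move=> o o2 /eqP h1 /eqP h2; rewrite (XZ _ _ h1) (YZ _ _ h2).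
apply: (@le_trans _ _ (\sum_(o2 | Z o2 == Z o1) P o1 * P o2 / atom P Z o1)).
  apply: ler_sum => o2 /eqP h2.
  rewrite -mulr_sumr ler_wpM2l ?mulr_ge0//.
  have zE o : (X o1 == X o) && (Y o2 == Y o) -> atom P Z o = atom P Z o1.
    by move=> /andP[/eqP h _]; rewrite /atom (XZ _ _ h).
  under eq_bigr => o /zE ho do rewrite ho invfM mulrA.
  rewrite -mulr_suml -[leRHS]mul1r ler_wpM2r ?invr_ge0 ?a0//.
  (* The compatible [o] form a whole fibre of [XY] or none at all. A fibre's mass cancels
     [atom P XY], and a null fibre contributes 0 because 0 / 0 = 0. *)
  case: (pickP (fun o => (X o1 == X o) && (Y o2 == Y o))) =>
      [o0 /andP[/eqP e1 /eqP e2]|h]; last by rewrite big_pred0.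
  have xyE o : (X o1 == X o) && (Y o2 == Y o) -> atom P XY o = atom P XY o0.
    by move=> /andP[/eqP f1 /eqP f2]; rewrite /atom /XY -f1 -f2 e1 e2.
  under eq_bigr => o /xyE ho do rewrite ho.
  rewrite -mulr_suml.
  have -> : \sum_(o | (X o1 == X o) && (Y o2 == Y o)) P o = atom P XY o0.
    by apply: eq_bigl => o; rewrite xpair_eqE e1 e2 [X o == _]eq_sym [Y o == _]eq_sym.
  by have [->|h] := eqVneq (atom P XY o0) 0; [rewrite mul0r | rewrite divff].
rewrite -mulr_suml -mulr_sumr -[\sum_(_ | _) _]/(atom P Z o1).
have [->|/pos h] := eqVneq (P o1) 0; first by rewrite !mul0r.
by rewrite mulfK// gt_eqF// atom_gt0.
Qed.

(** Submodularity for [(X, Z)] and [Y], both of which determine [Z]: conditioning on the finer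
    variable cannot increase entropy. *)
Lemma cond_entropy_determines P A B C (X : Omega -> A) (Y : Omega -> B)
    (Z : Omega -> C) : (forall o, 0 <= P o) -> determines Y Z ->
  cond_entropy P X Y <= cond_entropy P X Z.
Proof.
move=> P0 YZ; rewrite !cond_entropyE// lerBlDr addrAC lerBrDr.
have h : determines (fun o => (X o, Z o)) Z by move=> o o' [].
apply: le_trans (entropy_submodular P0 h YZ).
by rewrite lerD2r entropy_le// => o o' [-> _ ->].
Qed.

Lemma eq_cond_entropy P A B A' B' (X : Omega -> A) (Y : Omega -> B)
    (X' : Omega -> A') (Y' : Omega -> B') : (forall o, 0 <= P o) ->
  determines Y Y' -> determines Y' Y ->
  determines (fun o => (X o, Y o)) X' -> determines (fun o => (X' o, Y' o)) X ->
  cond_entropy P X Y = cond_entropy P X' Y'.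
Proof.
move=> P0 YY' Y'Y XX' X'X; rewrite !cond_entropyE//; congr (_ - _).
  apply: entropy_eq => // o o' e; congr (_, _); try by [apply: XX' | apply: X'X].
    by apply: YY'; case: e.
  by apply: Y'Y; case: e.
exact: entropy_eq.
Qed.

(** Symmetry of conditional mutual information: the definition subtracts entropies of the input,
    while the converse produces entropies of the output. *)
Lemma cond_mutual_infoE P A B C (X : Omega -> A) (Y : Omega -> B)
    (Z : Omega -> C) : (forall o, 0 <= P o) ->
  cond_mutual_info P X Y Z =
  cond_entropy P Y Z - cond_entropy P Y (fun o => (X o, Z o)).
Proof.
move=> P0; rewrite /cond_mutual_info !cond_entropyE//.
rewrite (@entropy_eq _ _ _ (fun o => (X o, (Y o, Z o))) (fun o => (Y o, (X o, Z o))))//;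
  first ring.
all: by move=> o o' [] -> -> ->.
Qed.

End EntropyBasics.

Section Fano.
Context {R : realType} {Omega : finType}.
Implicit Types (P : Omega -> R) (A B C D : finType).

Lemma cond_entropy_atomE P A B (X : Omega -> A) (Y : Omega -> B) :
  (forall o, 0 <= P o) ->
  cond_entropy P X Y =
  - \sum_o P o * (ln (atom P (fun o => (X o, Y o)) o) - ln (atom P Y o)).
Proof.
move=> P0; rewrite cond_entropyE// !entropyE opprK addrC -opprB; congr (- _).
by rewrite -sumrB; apply: eq_bigr => o _; rewrite mulrBr.
Qed.

(* Gibbs' inequality against the conditional law that puts mass 1/2 on the guess
   and spreads the other half uniformly. *)
Lemma fano P A B (X : Omega -> A) (Z : Omega -> B) (g : B -> A) :
  (forall o, 0 <= P o) -> \sum_o P o = 1 ->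
  cond_entropy P X Z <=
  ln 2 + prob P (fun o => g (Z o) != X o) * ln #|A|%:R.
Proof.
move=> P0 P1.
have pos o : P o != 0 -> 0 < P o by move=> h; rewrite lt_neqAle eq_sym h P0.
have [oo _|O0] := pickP Omega; last first.
  by move/eqP: P1; rewrite big_pred0// eq_sym oner_eq0.
have A0 : 0 < #|A|%:R :> R by rewrite ltr0n; apply/card_gt0P; exists (X oo).
(* The second half is divided by [#|A|] rather than by [#|A| - 1], which may be 0; a total mass of
   at most 1 is enough for Gibbs' inequality. *)
pose q (z : B) (a : A) : R := if g z == a then 2^-1 else (2 * #|A|%:R)^-1.
have q0 z a : 0 < q z a by rewrite /q; case: ifP => _; rewrite invr_gt0// mulr_gt0.
have q1 z : \sum_a q z a <= 1.
  rewrite (bigD1 (g z))//= {1}/q eqxx.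
  apply: (@le_trans _ _ (2^-1 + \sum_(a : A) (2 * #|A|%:R)^-1)).
    rewrite lerD2l [leRHS](bigD1 (g z))//= ler_wpDl ?invr_ge0 ?mulr_ge0 ?(ltW A0)//.
    by apply: ler_sum => a ha; rewrite /q eq_sym (negbTE ha).
  rewrite (_ : \sum_a _ = 2^-1); first lra.
  by rewrite sumr_const -[LHS]mulr_natl invfM mulrCA mulfV ?mulr1// gt_eqF.
set XZ := fun o => (X o, Z o).
have a0 A' (V : Omega -> A') o : 0 <= atom P V o.
  exact: le_trans (P0 _) (ge_atom _ _ P0).
pose r o := P o * (atom P Z o * q (Z o) (X o) / atom P XZ o).
have sr : \sum_o r o <= 1.
  have rE o : r o = \sum_(o1 | Z o1 == Z o) P o1 * (P o * q (Z o1) (X o) / atom P XZ o).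
    rewrite (eq_bigr (fun o1 => P o1 * (P o * q (Z o) (X o) / atom P XZ o))) => [|o1 /eqP -> //].
    by rewrite -mulr_suml -[\sum_(_ | _) _]/(atom P Z o) /r; ring.
  under eq_bigr do rewrite rE.
  rewrite (exchange_big_dep xpredT)//= -P1; apply: ler_sum => o1 _.
  rewrite -mulr_sumr -[leRHS]mulr1 ler_wpM2l//.
  apply: le_trans (q1 (Z o1)).
  rewrite (partition_big X xpredT)//=; apply: ler_sum => a _.
  case: (pickP (fun o => (Z o1 == Z o) && (X o == a))) => [o0 /andP[/eqP e1 /eqP e2]|h]; last first.
    by rewrite big_pred0// ltW.
  rewrite (eq_bigr (fun o => P o * (q (Z o1) a / atom P XZ o0))); last first.
    move=> o /andP[/eqP f1 /eqP f2]; rewrite f2 -mulrA; congr (_ * (_ / _)).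
    by rewrite /atom /XZ e2 f2 -e1 -f1.
  rewrite -mulr_suml.
  have -> : \sum_(o | (Z o1 == Z o) && (X o == a)) P o = atom P XZ o0.
    by apply: eq_bigl => o; rewrite xpair_eqE e1 e2 [Z o == _]eq_sym andbC.
  by have [->|h] := eqVneq (atom P XZ o0) 0; [rewrite mul0r ltW | rewrite mulrC divfK].
have key : \sum_o P o * (ln (atom P Z o * q (Z o) (X o)) - ln (atom P XZ o)) <= 0.
  apply: (@le_trans _ _ (\sum_o (r o - P o))); last by rewrite sumrB P1 subr_le0.
  apply: ler_sum => o _.
  have [Po|/pos Po] := eqVneq (P o) 0; first by rewrite /r Po !mul0r subrr.
  by apply: gibbs_term => //; rewrite ?mulr_gt0 ?atom_gt0.
rewrite cond_entropy_atomE// -subr_le0; apply: le_trans key.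
have -> : ln 2 + prob P (fun o => g (Z o) != X o) * ln #|A|%:R =
    \sum_o P o * (ln 2 + (g (Z o) != X o)%:R * ln #|A|%:R).
  under eq_bigr do rewrite mulrDr; rewrite big_split/= -mulr_suml P1 mul1r.
  congr (_ + _); rewrite /prob mulr_suml big_mkcond/=; apply: eq_bigr => o _.
  by case: ifP => _; rewrite ?mul1r// mul0r mulr0.
rewrite -opprD -big_split/= -sumrN; apply: ler_sum => o _.
have [Po|/pos Po] := eqVneq (P o) 0; first by rewrite Po !mul0r addr0 oppr0.
rewrite -mulrDr -mulrN ler_pM2l// lnM ?posrE ?atom_gt0//.
rewrite /q; case: eqP => _ /=; first by rewrite lnV ?posrE//; lra.
by rewrite lnV ?posrE ?mulr_gt0// lnM ?posrE//; lra.
Qed.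

End Fano.

(** * Images and mixtures of laws *)

Section Pushforward.
Context {R : realType} {Omega Omega' : finType}.

Lemma prob_pushforward (P : Omega -> R) (Q : Omega' -> R) (Z : Omega -> Omega')
    (E : pred Omega') :
  (forall o, Q o = prob P (fun o' => Z o' == o)) ->
  prob Q E = prob P (fun o => E (Z o)).
Proof.
move=> QE; rewrite /prob [RHS](partition_big Z E)//=.
apply: eq_bigr => o Eo; rewrite QE; apply: eq_bigl => o'.
by case: eqP => [->|]; rewrite ?andbF ?andbT ?Eo.
Qed.

Lemma cond_entropy_pushforward (P : Omega -> R) (Q : Omega' -> R)
    (Z : Omega -> Omega') (A B : finType) (X : Omega' -> A) (Y : Omega' -> B) :
  (forall o, Q o = prob P (fun o' => Z o' == o)) ->
  cond_entropy Q X Y = cond_entropy P (fun o => X (Z o)) (fun o => Y (Z o)).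
Proof.
move=> QE; rewrite /cond_entropy; congr (- _).
by apply: eq_bigr => a _; apply: eq_bigr => b _; rewrite !(prob_pushforward _ QE).
Qed.

End Pushforward.

Section Mixture.
Context {R : realType} {K Omega : finType}.

Definition mixture (l : K -> R) (P : K -> Omega -> R) (ko : K * Omega) : R :=
  l ko.1 * P ko.1 ko.2.

Lemma mixture_ge0 l P : (forall k, 0 <= l k) -> (forall k o, 0 <= P k o) ->
  forall ko, 0 <= mixture l P ko.
Proof. by move=> l0 P0 [k o]; rewrite mulr_ge0. Qed.

Lemma sum_mixture l P : (forall k, \sum_o P k o = 1) ->
  \sum_ko mixture l P ko = \sum_k l k.
Proof.
move=> P1; rewrite -(pair_bigA _ (fun k o => l k * P k o))/=.
by apply: eq_bigr => k _; rewrite -mulr_sumr P1 mulr1.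
Qed.

Lemma atom_mixture l P (A : finType) (X : K -> Omega -> A) k o :
  atom (mixture l P) (fun ko => (X ko.1 ko.2, ko.1)) (k, o) =
  l k * atom (P k) (X k) o.
Proof.
rewrite /atom /prob.
transitivity (\sum_(j | j == k) \sum_(o' | X j o' == X k o) l j * P j o').
  rewrite pair_big_dep/=; apply: eq_big => [[j o']|[j o'] _//] /=.
  by rewrite xpair_eqE andbC.
by rewrite big_pred1_eq mulr_sumr.
Qed.

(** With the index among the conditioning variables, both atoms carry the same factor [l k], which
    cancels in the difference of logarithms. Adjoining [Y] and the index to the first argument
    brings both atoms to the form of [atom_mixture]. *)
Lemma cond_entropy_mixture l P (A B : finType) (X : K -> Omega -> A)
    (Y : K -> Omega -> B) :
  (forall k, 0 <= l k) -> (forall k o, 0 <= P k o) ->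
  cond_entropy (mixture l P) (fun ko => X ko.1 ko.2)
    (fun ko => (Y ko.1 ko.2, ko.1)) =
  \sum_k l k * cond_entropy (P k) (X k) (Y k).
Proof.
move=> l0 P0; have m0 := mixture_ge0 l0 P0.
pose XY k o := (X k o, Y k o).
transitivity (cond_entropy (mixture l P) (fun ko => XY ko.1 ko.2)
    (fun ko => (Y ko.1 ko.2, ko.1))).
  by apply: eq_cond_entropy => //; rewrite /XY; determine.
transitivity (cond_entropy (mixture l P) (fun ko => (XY ko.1 ko.2, ko.1))
    (fun ko => (Y ko.1 ko.2, ko.1))).
  by apply: eq_cond_entropy => //; rewrite /XY; determine.
rewrite cond_entropyE//.
rewrite (@entropy_eq _ _ _ _ _ _ (fun ko => (XY ko.1 ko.2, ko.1)))//;
  try by rewrite /XY; determine.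
rewrite !entropyE opprK addrC -opprB -sumrB -sumrN.
rewrite -(pair_bigA _ (fun k o => - (mixture l P (k, o) *
   ln (atom (mixture l P) (fun ko => (XY ko.1 ko.2, ko.1)) (k, o)) -
   mixture l P (k, o) *
   ln (atom (mixture l P) (fun ko => (Y ko.1 ko.2, ko.1)) (k, o)))))/=.
apply: eq_bigr => k _; rewrite cond_entropy_atomE// mulrN mulr_sumr -sumrN.
apply: eq_bigr => o _; rewrite !atom_mixture /mixture/=.
have [->|lk] := eqVneq (l k) 0; first by rewrite !mul0r subr0.
have [->|Po] := eqVneq (P k o) 0; first by rewrite !(mul0r, mulr0) subr0.
have {}lk : 0 < l k by rewrite lt_neqAle eq_sym lk l0.
have {}Po : 0 < P k o by rewrite lt_neqAle eq_sym Po P0.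
by rewrite !lnM ?posrE ?atom_gt0//; rewrite /XY; ring.
Qed.

End Mixture.

(** * Channel outputs and the chain rule *)

Section ChannelOutput.
Context {R : realType}.
Implicit Types (Omega A B T : finType).

(* [Y] is the output of the channel [c] on input [X], and depends on the history
   [H] only through [X]; quantifying over the events decided by [H] makes the
   property inherited by every coarser history, even one that does not
   determine [X]. *)
Definition channel_output Omega A B (T : Type) (P : Omega -> R) (H : Omega -> A)
    (X : Omega -> T) (Y : Omega -> B) (c : T -> B -> R) : Prop :=
  forall E : pred Omega, determines H E -> forall b,
  \sum_(o | E o && (Y o == b)) P o = \sum_(o | E o) P o * c (X o) b.

Lemma channel_output_determines Omega A A' B (T : Type) (P : Omega -> R)
    (H : Omega -> A) (H' : Omega -> A') (X : Omega -> T) (Y : Omega -> B) c :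
  determines H H' -> channel_output P H X Y c -> channel_output P H' X Y c.
Proof. by move=> HH' h E HE b; apply: h => o o' /HH' /HE. Qed.

(** On each fibre of [H], itself an event decided by [H], the function [f] is constant; this extends
    the defining property from events to weights. *)
Lemma channel_output_weight Omega A B (T : Type) (P : Omega -> R)
    (H : Omega -> A) (X : Omega -> T) (Y : Omega -> B) c b (f : Omega -> R) :
  channel_output P H X Y c -> determines H f ->
  \sum_(o | Y o == b) P o * f o = \sum_o P o * c (X o) b * f o.
Proof.
move=> h Hf; rewrite (partition_big H xpredT)//= [RHS](partition_big H xpredT)//=.
apply: eq_bigr => a _.
have [o0 /eqP o0a|na] := pickP (fun o => H o == a); last first.
  by rewrite !big_pred0// => o; rewrite na ?andbF.
have fE o : H o == a -> f o = f o0 by move=> /eqP oa; apply: Hf; rewrite oa.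
rewrite (eq_bigr (fun o => P o * f o0)) => [|o /andP[_ /fE -> //]].
rewrite [RHS](eq_bigr (fun o => P o * c (X o) b * f o0)) => [|o /fE -> //].
rewrite -!mulr_suml -h; first by under eq_bigl do rewrite andbC.
by move=> o o' ->.
Qed.

(** On an atom of [H] the joint mass with the output is [atom P H o * c (X o) (Y o)], so only the
    channel factor is left. The right side does not mention [H]: all histories that determine the
    input give the same conditional entropy, which allows a long past to be exchanged for the
    input. *)
Lemma cond_entropy_channel_output Omega A B (T : Type) (P : Omega -> R)
    (H : Omega -> A) (X : Omega -> T) (Y : Omega -> B) c :
  (forall o, 0 <= P o) -> determines H X -> channel_output P H X Y c ->
  cond_entropy P Y H = - \sum_o P o * \sum_b c (X o) b * ln (c (X o) b).
Proof.
move=> P0 HX h; rewrite cond_entropy_atomE//; congr (- _).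
transitivity (\sum_o P o * ln (c (X o) (Y o))).
  apply: eq_bigr => o _.
  have [->|Po] := eqVneq (P o) 0; first by rewrite !mul0r.
  have {}Po : 0 < P o by rewrite lt_neqAle eq_sym Po P0.
  have aE : atom P (fun o => (Y o, H o)) o = atom P H o * c (X o) (Y o).
    rewrite /atom /prob mulr_suml.
    transitivity (\sum_(o' | (H o' == H o) && (Y o' == Y o)) P o').
      by apply: eq_bigl => o'; rewrite xpair_eqE andbC.
    rewrite h => [|o1 o2 -> //]; apply: eq_bigr => o' /eqP e.
    by rewrite (HX _ _ e).
  have a1 : 0 < atom P (fun o => (Y o, H o)) o by exact: atom_gt0.
  have a2 : 0 < atom P H o by exact: atom_gt0.
  rewrite aE lnM ?posrE//; first by congr (_ * _); ring.
  by move: a1; rewrite aE pmulr_rgt0.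
rewrite (partition_big Y xpredT)//=
  [RHS](eq_bigr (fun o => \sum_b P o * c (X o) b * ln (c (X o) b))); last first.
  by move=> o _; rewrite mulr_sumr; apply: eq_bigr => b _; rewrite mulrA.
rewrite exchange_big/=; apply: eq_bigr => b _.
rewrite -(channel_output_weight b (f := fun o => ln (c (X o) b)) h) => [|o o' /HX -> //].
by apply: eq_bigr => o /eqP ->.
Qed.

Lemma channel_output_mixture (K : finType) Omega A B (T : Type) (l : K -> R)
    (P : K -> Omega -> R) (H : K -> Omega -> A) (X : K -> Omega -> T)
    (Y : K -> Omega -> B) c :
  (forall k, channel_output (P k) (H k) (X k) (Y k) c) ->
  channel_output (mixture l P) (fun ko => (H ko.1 ko.2, ko.1))
    (fun ko => X ko.1 ko.2) (fun ko => Y ko.1 ko.2) c.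
Proof.
move=> h E HE b.
transitivity (\sum_k \sum_(o | E (k, o)) mixture l P (k, o) * c (X k o) b);
  last by rewrite pair_big_dep/=; apply: eq_big => [[k o]|[k o]].
transitivity (\sum_k \sum_(o | E (k, o) && (Y k o == b)) mixture l P (k, o)).
  by rewrite pair_big_dep/=; apply: eq_big => [[k o]|[k o]].
apply: eq_bigr => k _; rewrite /mixture/= -mulr_sumr.
rewrite (h k (fun o => E (k, o))) => [|o o' e]; last by apply: HE; rewrite /= e.
by rewrite mulr_sumr; apply: eq_bigr => o _; rewrite mulrA.
Qed.

(** Needed for the cut where only the receiver's component of the output pair is observed. *)
Lemma channel_output_map Omega A B B' (T : Type) (P : Omega -> R)
    (H : Omega -> A) (X : Omega -> T) (Y : Omega -> B) c (f : B -> B') :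
  channel_output P H X Y c ->
  channel_output P H X (fun o => f (Y o)) (fun x b' => \sum_(b | f b == b') c x b).
Proof.
move=> h E HE b'; rewrite (partition_big Y (fun b => f b == b'))/=; last first.
  by move=> o /andP[].
under [RHS]eq_bigr do rewrite mulr_sumr.
rewrite exchange_big/=; apply: eq_bigr => b /eqP fb.
rewrite -h//; apply: eq_bigl => o.
by case: (Y o =P b) => [->|]; rewrite ?andbF// fb eqxx !andbT.
Qed.

End ChannelOutput.

Section Chain.
Context {R : realType} {Omega : finType} (P : Omega -> R).
Context (P0 : forall o, 0 <= P o).
Context {n : nat} {B : finType}.

(* Masked rather than truncated, so that prefixes of all lengths share a type. *)
Definition prefix (u : {ffun 'I_n -> B}) (k : nat) : {ffun 'I_n -> option B} :=
  [ffun j : 'I_n => if (j < k)%N then Some (u j) else None].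

Lemma prefixP u u' k :
  prefix u k = prefix u' k <-> (forall j : 'I_n, (j < k)%N -> u j = u' j).
Proof.
split=> [/ffunP h j jk|h]; last first.
  by apply/ffunP => j; rewrite !ffunE; case: ifP => // /h ->.
by have := h j; rewrite !ffunE jk => -[].
Qed.

Context (U : Omega -> {ffun 'I_n -> B}).

Lemma cond_entropy_chain (A : finType) (C : Omega -> A) :
  cond_entropy P U C =
  \sum_(k < n) cond_entropy P (fun o => U o k) (fun o => (prefix (U o) k, C o)).
Proof.
pose h k := entropy P (fun o => (prefix (U o) k, C o)).
have hS (k : 'I_n) : cond_entropy P (fun o => U o k)
    (fun o => (prefix (U o) k, C o)) = h k.+1 - h k.
  rewrite cond_entropyE// /h; congr (_ - _); apply: entropy_eq => // o o' /=.
    move=> [e1 /prefixP e2 ->]; congr (_, _); apply/prefixP => j.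
    rewrite ltnS leq_eqVlt => /orP[/eqP/val_inj -> //|]; exact: e2.
  move=> [/prefixP e ->]; congr (_, (_, _)); first exact: e.
  by apply/prefixP => j jk; apply: e; rewrite ltnW.
rewrite (eq_bigr (fun k : 'I_n => h k.+1 - h k)) => [|k _]; last exact: hS.
rewrite -(big_mkord xpredT (fun k => h k.+1 - h k)) telescope_sumr//.
rewrite cond_entropyE//; congr (_ - _); apply: entropy_eq => // o o' /=.
- by move=> [-> ->].
- move=> [/prefixP e ->]; congr (_, _); apply/ffunP => j; exact: e.
- by move=> ->; congr (_, _); apply/prefixP.
- by case.
Qed.

(** Since [F] determines [C], H(F|C) = H(F|U,C) + H(U|C) - H(U|F). The chain rule splits the last
    two entropies over time; replacing the conditioning by the coarser [DX] raises the first, and by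
    the finer [GX] lowers the second. *)
Lemma converse (A A' : finType) (D G : 'I_n -> finType)
    (F : Omega -> A) (C : Omega -> A')
    (DX : forall k, Omega -> D k) (GX : forall k, Omega -> G k) :
  determines F C ->
  (forall k : 'I_n, determines (fun o => (prefix (U o) k, C o)) (DX k)) ->
  (forall k : 'I_n, determines (GX k) (fun o => (prefix (U o) k, F o))) ->
  cond_entropy P F C <= cond_entropy P F (fun o => (U o, C o)) +
  \sum_(k < n) (cond_entropy P (fun o => U o k) (DX k) -
                cond_entropy P (fun o => U o k) (GX k)).
Proof.
move=> FC hD hG.
have -> : cond_entropy P F C = cond_entropy P F (fun o => (U o, C o)) +
    (cond_entropy P U C - cond_entropy P U F).
  rewrite !cond_entropyE//.
  rewrite (@entropy_eq _ _ _ _ _ (fun o => (F o, C o)) F)//; last first.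
  - by move=> o o' e; rewrite (FC _ _ e) e.
  - by move=> o o' [].
  rewrite (@entropy_eq _ _ _ _ _ (fun o => (F o, (U o, C o))) (fun o => (U o, F o)))//; first ring.
  - by move=> o o' [-> ->].
  - by move=> o o' [-> e]; rewrite (FC _ _ e) e.
rewrite lerD2l !cond_entropy_chain -sumrB; apply: ler_sum => k _.
by rewrite lerB// cond_entropy_determines.
Qed.

End Chain.

(** * Causal and memoryless product laws *)

Section Causal.
Context {R : realType} {n : nat} {B : finType}.
Implicit Types (u : {ffun 'I_n -> B}).

Definition causal (S : Type) (k : nat) (g : {ffun 'I_n -> B} -> S) : Prop :=
  forall u u', (forall j : 'I_n, (j < k)%N -> u j = u' j) -> g u = g u'.

Definition update u (k : 'I_n) (b : B) : {ffun 'I_n -> B} :=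
  [ffun j => if j == k then b else u j].

Lemma causal_update (S : Type) (g : {ffun 'I_n -> B} -> S) (k : nat) u (j : 'I_n) b :
  causal k g -> (k <= j)%N -> g (update u j b) = g u.
Proof.
move=> hg kj; apply: hg => i ik; rewrite ffunE; case: eqP => // ij.
by move: ik; rewrite ij ltnNge kj.
Qed.

(** Exchanging coordinate [k] of [u] with [b] is an involution on pairs, so every value of [f] is
    counted once for each letter. *)
Lemma sum_update (f : {ffun 'I_n -> B} -> R) (k : 'I_n) :
  \sum_u \sum_b f (update u k b) = #|B|%:R * \sum_u f u.
Proof.
pose phi (ub : {ffun 'I_n -> B} * B) := (update ub.1 k ub.2, ub.1 k).
have phiK : involutive phi.
  move=> [u b]; rewrite /phi/=; congr (_, _); last by rewrite ffunE eqxx.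
  by apply/ffunP => j; rewrite !ffunE; case: eqP => [->|].
rewrite pair_bigA/= (reindex_inj (inv_inj phiK))/=.
rewrite -(pair_bigA _ (fun u b => f (update (update u k b) k (u k))))/= mulr_sumr.
apply: eq_bigr => u _; rewrite (eq_bigr (fun=> f u)) => [|b _].
  by rewrite sumr_const mulr_natl.
by congr f; apply/ffunP => j; rewrite !ffunE; case: eqP => [->|].
Qed.

Context (K : 'I_n -> {ffun 'I_n -> B} -> B -> R).
Context (causalK : forall k : 'I_n, causal k (K k)).
Context (sumK : forall k u, \sum_b K k u b = 1).

Let past_prod k u := \prod_(j < n | (j < k)%N) K j u (u j).

Let past_prod_causal k : causal k (past_prod k).
Proof.
move=> u u' e; apply: eq_bigr => j jk; rewrite e//.
by rewrite (@causalK j u u')// => i ij; apply: e; apply: ltn_trans jk.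
Qed.

Let past_prodS (k : 'I_n) u : past_prod k.+1 u = K k u (u k) * past_prod k u.
Proof.
rewrite /past_prod (bigD1 k)//=; congr (_ * _); apply: eq_bigl => j.
by rewrite ltnS [RHS]ltn_neqAle andbC.
Qed.

(* Resampling coordinate [k] (sum_update) replaces the factor of time [k] by its
   sum, which is 1; this peels the factors off from the last one. *)
Lemma sum_past_prod (g : {ffun 'I_n -> B} -> R) (d k : nat) :
  (k + d)%N = n -> causal k g ->
  \sum_u g u * past_prod k u =
  #|B|%:R ^+ d * \sum_u g u * \prod_j K j u (u j).
Proof.
elim: d k => [|d IHd] k kn hg.
  rewrite expr0 mul1r; apply: eq_bigr => u _; congr (_ * _).
  by apply: eq_bigl => j; rewrite -[n]kn addn0 in j *; rewrite ltn_ord.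
have kn' : (k < n)%N by rewrite -kn addnS ltnS leq_addr.
have hg' : causal k.+1 g by move=> u u' e; apply: hg => j jk; apply: e; rewrite ltnW.
rewrite exprS -mulrA -(IHd k.+1) ?addSn ?addnS -?[RHS]addnS//; last by rewrite -addnS.
rewrite -(sum_update _ (Ordinal kn')); apply: eq_bigr => u _.
under eq_bigr => b _ do
  rewrite (causal_update _ _ hg)// (past_prodS (Ordinal kn')) ffunE eqxx
    (causal_update _ _ (@causalK _))// (causal_update _ _ (past_prod_causal (k := k)))//.
by rewrite -mulr_sumr -mulr_suml sumK mul1r.
Qed.

Lemma causal_channel (g : {ffun 'I_n -> B} -> R) (k : 'I_n) b :
  causal k g ->
  \sum_(u : {ffun 'I_n -> B} | u k == b) g u * \prod_j K j u (u j) =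
  \sum_u g u * K k u b * \prod_j K j u (u j).
Proof.
move=> hg.
have B0 : #|B|%:R != 0 :> R by rewrite pnatr_eq0 -lt0n; apply/card_gt0P; exists b.
have kd : (k.+1 + (n - k.+1))%N = n by rewrite subnKC.
(* Powers of [#|B|] count the free continuations and turn both sides into sums over [past_prod]: at
   level [k.+1] on the left, where the summand looks at coordinate [k], and at level [k] on the
   right. Resampling coordinate [k] links the two. *)
apply: (mulfI (expf_neq0 (n - k.+1).+1 B0)).
pose h u := g u * K k u b.
have hh : causal k h.
  by move=> u u' e; rewrite /h (hg u u')// (causalK e).
rewrite -[RHS](@sum_past_prod h _ k)//; last by rewrite addnS -addSn.
rewrite exprS -mulrA big_mkcond/=.
rewrite (eq_bigr (fun u => (g u * (u k == b)%:R) * \prod_j K j u (u j))); last first.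
  by move=> u _; case: eqP => _; rewrite ?mulr1// mulr0 mul0r.
rewrite -(@sum_past_prod (fun u => g u * (u k == b)%:R) _ k.+1)//; last first.
  move=> u u' e; rewrite (hg u u') ?e// => j jk; exact/e/ltnW.
rewrite -(sum_update _ k); apply: eq_bigr => u _.
rewrite (bigD1 b)//= big1 => [|b' /negbTE bb']; last first.
  by rewrite ffunE eqxx bb' mulr0 mul0r.
rewrite addr0 (causal_update _ _ hg)// past_prodS ffunE !eqxx mulr1.
rewrite (causal_update _ _ (@causalK _))// (causal_update _ _ (@past_prod_causal k))//.
by rewrite mulrA.
Qed.

Lemma sum_causal : (0 < #|B|)%N -> \sum_u \prod_j K j u (u j) = 1.
Proof.
move=> B0.
have h := @sum_past_prod (fun=> 1) n 0 (add0n n) (fun _ _ _ => erefl).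
have {}B0 : #|B|%:R ^+ n != 0 :> R by rewrite expf_neq0// pnatr_eq0 -lt0n.
apply: (mulfI B0); under eq_bigr do rewrite -[\prod_j _]mul1r.
rewrite -h mulr1 (eq_bigr (fun=> 1)) => [|u _]; last by rewrite /past_prod big_pred0// mul1r.
by rewrite sumr_const card_ffun card_ord natrX.
Qed.

End Causal.

Definition letterwise (T A : finType) (m : nat) (g : T -> A)
  (t : {ffun 'I_m -> T}) : {ffun 'I_m -> A} := [ffun j => g (t j)].

Lemma letterwise_determines (T A B : finType) (m : nat) (g : T -> A) (h : T -> B) :
  determines g h -> determines (@letterwise T A m g) (@letterwise T B m h).
Proof.
move=> gh t t' /ffunP e; apply/ffunP => j; rewrite !ffunE; apply: gh.
by move: (e j); rewrite !ffunE.
Qed.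

Section Product.
Context {R : realType} {T : finType} (p : T -> R) (m : nat).
Context (p0 : forall t, 0 <= p t).
Context (p1 : \sum_t p t = 1).

Definition iid (t : {ffun 'I_m -> T}) : R := \prod_j p (t j).

Lemma iid_ge0 t : 0 <= iid t. Proof. exact: prodr_ge0. Qed.

Lemma sum_iid : \sum_t iid t = 1.
Proof.
by rewrite /iid -(bigA_distr_bigA (fun=> p))/= big1.
Qed.

Lemma ln_prod (I : finType) (x : I -> R) : (forall i, 0 < x i) ->
  ln (\prod_i x i) = \sum_i ln (x i).
Proof.
move=> x0; suff [] : 0 < \prod_i x i /\ ln (\prod_i x i) = \sum_i ln (x i) by [].
elim/big_rec2: _ => [|i y z _ [y0 e]]; first by rewrite ln1 ltr01.
by rewrite mulr_gt0// lnM ?posrE// e.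
Qed.

(** The logarithm of the product is a sum of [m] terms. Each of them, summed over all blocks,
    factors into one copy of [r b * ln (r b)] and total masses 1. *)
Lemma entropy_iid (A : finType) (g : T -> A) :
  entropy iid (letterwise g) = m%:R * entropy p g.
Proof.
pose r a := prob p (fun t => g t == a).
have r1 : \sum_a r a = 1.
  by rewrite -p1 (partition_big g xpredT).
have pr a : prob iid (fun t => [ffun j => g (t j)] == a) = \prod_j r (a j).
  rewrite /r /prob bigA_distr_big_dep/=; apply: eq_bigl => t.
  apply/eqP/familyP => [<- j|h]; first by rewrite ffunE unfold_in/= eqxx.
  by apply/ffunP => j; rewrite ffunE; apply/eqP/h.
rewrite /entropy mulrN; congr (- _).
under eq_bigr do rewrite pr.
pose F (i j : 'I_m) b := if j == i then r b * ln (r b) else r b.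
transitivity (\sum_(a : {ffun 'I_m -> A}) \sum_i \prod_j F i j (a j)).
  apply: eq_bigr => a _.
  have FE i : \prod_j F i j (a j) = \prod_j r (a j) * ln (r (a i)).
    rewrite (bigD1 i)//= [in RHS](bigD1 i)//= {1}/F eqxx mulrAC; congr (_ * _ * _).
    by apply: eq_bigr => j /negbTE ji; rewrite /F ji.
  rewrite (eq_bigr _ (fun i _ => FE i)).
  (* If some letter has probability 0, the logarithm need not split, but the product in front of it
     vanishes on both sides. *)
  rewrite -mulr_sumr; have [|] := boolP [forall j, 0 < r (a j)].
    by move=> /forallP h; rewrite ln_prod.
  rewrite negb_forall => /existsP[j]; rewrite -leNgt => rj.
  have rj0 : r (a j) = 0 by apply/le_anti; rewrite rj sumr_ge0.
  by rewrite (bigD1 j)//= rj0 !mul0r.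
rewrite exchange_big/= (eq_bigr (fun=> \sum_b r b * ln (r b))) => [|i _].
  by rewrite sumr_const card_ord mulr_natl.
rewrite -(bigA_distr_bigA (F i))/= (bigD1 i)//= [X in _ * X]big1 => [|j ji].
  by rewrite mulr1; apply: eq_bigr => b _; rewrite /F eqxx.
by rewrite -r1; apply: eq_bigr => b _; rewrite /F (negbTE ji).
Qed.

Lemma cond_entropy_iid (A B : finType) (g : T -> A) (h : T -> B) :
  cond_entropy iid (letterwise g) (letterwise h) =
  m%:R * cond_entropy p g h.
Proof.
rewrite !cond_entropyE// ?mulrBr; last exact: iid_ge0.
rewrite -!entropy_iid; congr (_ - _); apply: entropy_eq; first exact: iid_ge0.
- move=> o o' [/ffunP e1 /ffunP e2]; apply/ffunP => j.
  by move: (e1 j) (e2 j); rewrite !ffunE => -> ->.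
- by move=> o o' e; congr (_, _); apply: letterwise_determines e => ? ? [].
Qed.

End Product.

(** * Convexity and compactness *)

Section Caratheodory.
Context {R : realFieldType} {V : finType} {d : nat} (f : V -> 'I_d -> R).

Let same_moments (l l' : V -> R) :=
  \sum_v l' v = \sum_v l v /\
  forall i, \sum_v l' v * f v i = \sum_v l v * f v i.

(** Prefixing a coordinate 1 to each [f v] gives more than d + 1 vectors in dimension d + 1. A
    linear dependency among them has total weight 0 because of that coordinate. *)
Lemma affine_dependency (A : {set V}) : (d.+1 < #|A|)%N ->
  exists w : V -> R, [/\ forall v, v \notin A -> w v = 0, exists v, w v != 0,
    \sum_v w v = 0 & forall i, \sum_v w v * f v i = 0].
Proof.
move=> dA.
pose g (v : V) (i : 'I_d.+1) : R := if unlift ord0 i is Some j then f v j else 1.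
pose M : 'M[R]_(#|A|, d.+1) := \matrix_(k, i) g (enum_val k) i.
have : kermx M != 0.
  rewrite kermx_eq0 /row_free; apply/eqP => e.
  by have := rank_leq_col M; rewrite e leqNgt dA.
move=> /rowV0Pn[x /sub_kermxP xM x0].
pose w v := \sum_(k | enum_val k == v) x 0 k.
have wE (F : V -> R) : \sum_v w v * F v = \sum_k x 0 k * F (enum_val k).
  rewrite (partition_big (fun k : 'I_#|A| => enum_val k) xpredT)//=.
  by apply: eq_bigr => v _; rewrite mulr_suml; apply: eq_bigr => k /eqP ->.
have wg i : \sum_v w v * g v i = 0.
  have h : (x *m M) 0 i = 0 by rewrite xM mxE.
  by rewrite wE; apply: etrans h; rewrite mxE; apply: eq_bigr => k _; rewrite mxE.
exists w; split.
- move=> v vA; rewrite /w big_pred0// => k; apply/eqP => e.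
  by move: vA; rewrite -e enum_valP.
- move: x0 => /rV0Pn[k xk]; exists (enum_val k); rewrite /w.
  by rewrite (big_pred1 k)// => j; rewrite (inj_eq enum_val_inj).
- apply: etrans (wg ord0); apply: eq_bigr => v _.
  by rewrite /g unlift_none mulr1.
- move=> i; apply: etrans (wg (lift ord0 i)); apply: eq_bigr => v _.
  by rewrite /g liftK.
Qed.

(** Subtracting a multiple of an affine dependency [w] changes neither the total nor the moments.
    The least ratio [l v / w v] over positive [w v] is the largest multiple that keeps all weights
    nonnegative, and it removes one point of the support. *)
Lemma caratheodory_support (l : V -> R) : (forall v, 0 <= l v) ->
  exists l' : V -> R, [/\ forall v, 0 <= l' v, same_moments l l' &
    (#|[set v | l' v != 0%R]| <= d.+1)%N].
Proof.
have [s] := ubnP #|[set v | l v != 0%R]|.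
elim: s => // s IHs in l * => ls l0.
have [|dA] := leqP #|[set v | l v != 0%R]| d.+1; first by exists l.
have [w [wA [v1 wv1] w1 wf]] := affine_dependency dA.
have [v0 wv0] : exists v, 0 < w v.
  apply/existsP; apply: contraNT wv1 => /existsPn wle.
  have wn v : 0 <= - w v by rewrite oppr_ge0 leNgt; exact: wle.
  have /psumr_eq0P : \sum_v - w v = 0 by rewrite sumrN w1 oppr0.
  by move=> /(_ (fun v _ => wn v)) /(_ v1 isT) /eqP; rewrite oppr_eq0.
case: (@arg_minP _ _ _ v0 (fun v => 0 < w v) (fun v => l v / w v) wv0) => {v0 wv0} v0 wv0 vmin.
pose t := l v0 / w v0.
have t0 : 0 <= t by rewrite divr_ge0// ltW.
pose l' v := l v - t * w v.
have l'0 v : 0 <= l' v.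
  rewrite subr_ge0; have [wv|wv] := ltP 0 (w v).
    by rewrite -ler_pdivlMr// vmin.
  by rewrite (le_trans _ (l0 v))// mulr_ge0_le0.
have l'v0 : l' v0 = 0 by rewrite /l' /t divfK ?subrr// gt_eqF.
have sub : [set v | l' v != 0] \proper [set v | l v != 0].
  apply/properP; split.
    apply/fintype.subsetP => v; rewrite !inE; apply: contraNN => lv.
    by rewrite /l' (eqP lv) wA ?inE ?lv// mulr0 subr0.
  exists v0; rewrite inE ?l'v0 ?eqxx//.
  by apply: contraTneq wv0 => lv; rewrite wA ?ltxx// inE lv eqxx.
have [|l'' [l''0 [m1 m2] l''s]] := IHs l' _ l'0.
  by rewrite (leq_trans (proper_card sub)).
exists l''; split=> //; split=> [|i].
  by rewrite m1 /l' sumrB -mulr_sumr w1 mulr0 subr0.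
rewrite m2 /l'; under eq_bigr do rewrite mulrBl -mulrA.
by rewrite sumrB -mulr_sumr wf mulr0 subr0.
Qed.

Lemma caratheodory (l : V -> R) :
  (forall v, 0 <= l v) -> \sum_v l v = 1 ->
  exists (e : 'I_d.+1 -> V) (mu : 'I_d.+1 -> R),
  [/\ forall j, 0 <= mu j, \sum_j mu j = 1 &
      forall i, \sum_j mu j * f (e j) i = \sum_v l v * f v i].
Proof.
move=> l0 l1; have [l' [l'0 [m1 m2] As]] := caratheodory_support l0.
set A := [set v | _] in As.
have [v0 _] : exists v0, v0 \in V.
  have [v0 _|V0] := pickP V; first by exists v0.
  by move/eqP: l1; rewrite big_pred0// eq_sym oner_eq0.
(* When the support has fewer than [d.+1] points, the surplus indices point to [v0] with weight
   0. *)
pose e (j : nat) := nth v0 (enum A) j.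
pose mu (j : 'I_d.+1) := if (j < #|A|)%N then l' (e j) else 0.
have sumE (F : V -> R) : \sum_j mu j * F (e j) = \sum_v l' v * F v.
  transitivity (\sum_(j < d.+1 | (j < #|A|)%N) l' (e j) * F (e j)).
    rewrite [RHS]big_mkcond/=; apply: eq_bigr => j _; rewrite /mu.
    by case: ifP => // _; rewrite mul0r.
  rewrite -(big_ord_widen _ (fun j => l' (e j) * F (e j)) As).
  rewrite [RHS](bigID (mem A))/= [X in _ + X]big1 ?addr0 => [|v]; last first.
    by rewrite inE negbK => /eqP ->; rewrite mul0r.
  by rewrite -[RHS]big_enum/= [RHS](big_nth v0) big_mkord cardE.
exists (fun j : 'I_d.+1 => e j), mu; split.
- by move=> j; rewrite /mu; case: ifP.
- by rewrite -l1 -m1; have := sumE (fun=> 1); rewrite -!mulr_suml !mulr1.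
- by move=> i; rewrite (sumE (f^~ i)) m2.
Qed.

End Caratheodory.

Section Compactness.
Context {R : realType}.

Lemma continuous_xlnx : continuous (fun x : R => x * ln x).
Proof.
move=> x; have [x0|x0|->] := ltgtP x 0.
- have e : forall y : R, y < 0 -> y * ln y = 0 by move=> y y0; rewrite ln0 ?mulr0// ltW.
  rewrite /continuous_at (e x x0); apply: cvg_near_cst.
  by near=> y; rewrite e//; near: y; exact: lt_nbhsl.
- by apply: continuousM; [exact: cvg_id | exact: continuous_ln].
- rewrite /continuous_at mul0r; apply/cvgrPdist_lt => e e0.
  near=> y; rewrite sub0r normrN.
  have [y0|y0] := leP y 0; first by rewrite ln0// mulr0 normr0.
  have y1 : y < 1 by near: y; exact: lt_nbhsl.
  (* With y = s^2, the absolute value of y ln y is 2 s (s ln (1/s)), and s ln (1/s) <= 1 because ln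
     u < u; so it is at most 2 s. *)
  pose s := Num.sqrt y.
  have s0 : 0 < s by rewrite sqrtr_gt0.
  have ys : y = s ^+ 2 by rewrite sqr_sqrtr// ltW.
  have l0 : ln y <= 0 by rewrite ln_le0// ltW.
  rewrite ler0_norm; last by rewrite mulr_ge0_le0// ltW.
  rewrite -mulrN -lnV ?posrE//.
  have -> : y^-1 = (s^-1) ^+ 2 by rewrite ys exprVn.
  rewrite lnXn ?invr_gt0//.
  have h : ln s^-1 < s^-1 by rewrite ln_sublinear// invr_gt0.
  have : s * 2 < e.
    have : y < (e / 2) ^+ 2 by near: y; apply: lt_nbhsl; rewrite exprn_gt0// divr_gt0.
    rewrite ys ltr_pXn2r ?nnegrE ?ltW ?divr_gt0//; lra.
  apply: le_lt_trans; rewrite {1}ys expr2 -mulrA ler_pM2l// -mulr_natl.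
  have : s * ln s^-1 <= 1 by rewrite -[1](@divff _ s) ?gt_eqF// ler_pM2l// ltW.
  lra.
Unshelve. all: by end_near. Qed.

(** Row vectors carry the topology in which the unit cube is compact; [coords] reads them as
    functions on [T]. *)
Definition coords {T : finType} (v : 'rV[R]_#|T|) (t : T) : R := v 0 (enum_rank t).

Definition continuous_in_coords (T : finType) (F : (T -> R) -> R) : Prop :=
  continuous (fun v : 'rV[R]_#|T| => F (coords v)).

Section Closure.
Context {T : finType}.
Implicit Types F G : (T -> R) -> R.

Lemma cic_coord t : continuous_in_coords (fun x : T -> R => x t).
Proof. by move=> v; exact: coord_continuous. Qed.

Lemma cic_cst c : continuous_in_coords (fun _ : T -> R => c).
Proof. exact: cst_continuous. Qed.

Lemma cic_add F G : continuous_in_coords F -> continuous_in_coords G ->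
  continuous_in_coords (fun x => F x + G x).
Proof. by move=> cF cG v; exact: (continuousD (cF v) (cG v)). Qed.

Lemma cic_opp F : continuous_in_coords F -> continuous_in_coords (fun x => - F x).
Proof. by move=> cF v; exact: (continuousN (cF v)). Qed.

Lemma cic_mul F G : continuous_in_coords F -> continuous_in_coords G ->
  continuous_in_coords (fun x => F x * G x).
Proof. by move=> cF cG v; exact: (continuousM (cF v) (cG v)). Qed.

Lemma cic_norm F : continuous_in_coords F -> continuous_in_coords (fun x => `|F x|).
Proof. by move=> cF v; exact: (cvg_norm (cF v)). Qed.

Lemma cic_sum (I : Type) (r : seq I) (Q : pred I) (F : I -> (T -> R) -> R) :
  (forall i, continuous_in_coords (F i)) ->
  continuous_in_coords (fun x => \sum_(i <- r | Q i) F i x).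
Proof. by move=> cF; apply: continuous_big => [|i _]; [exact: add_continuous|exact: cF]. Qed.

Lemma cic_xlnx F : continuous_in_coords F ->
  continuous_in_coords (fun x => F x * ln (F x)).
Proof.
move=> cF v; apply: (@continuous_comp _ _ _ (fun v => F (coords v)) (fun x => x * ln x)).
  exact: (cF v).
exact: continuous_xlnx.
Qed.

Lemma cic_entropy (Omega A : finType) (q : (T -> R) -> Omega -> R) (X : Omega -> A) :
  (forall o, continuous_in_coords (q^~ o)) ->
  continuous_in_coords (fun x => entropy (q x) X).
Proof.
move=> cq; apply/cic_opp/cic_sum => a; apply: (cic_xlnx (F := fun x => prob (q x) _)).
exact: cic_sum.
Qed.

End Closure.

(** The classes of [cl] let one vector hold several probability laws, so the constraint set is a
    product of simplices and is compact. A continuous measure of the total deficit attains its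
    minimum there, and approximate solutions force this minimum down to 0. *)
Lemma simplices_limit (T J I : finType) (cl : T -> J)
    (F : I -> (T -> R) -> R) (h : I -> R) :
  let simplices (x : T -> R) :=
    (forall t, 0 <= x t) /\ forall j, \sum_(t | cl t == j) x t = 1 in
  (forall i, continuous_in_coords (F i)) ->
  (forall e, 0 < e -> exists2 x, simplices x & forall i, h i <= F i x + e) ->
  exists2 x, simplices x & forall i, h i <= F i x.
Proof.
move=> simplices cF hF.
have coordsP (x : T -> R) : exists v : 'rV[R]_#|T|, coords v = x.
  exists (\row_k x (enum_val k)); apply/funext => t.
  by rewrite /coords mxE enum_rankK.
pose D : set 'rV[R]_#|T| := [set v | simplices (coords v)]%classic.
have D0 : (D !=set0)%classic.
  by have [x xD _] := hF 1 ltr01; have [v vx] := coordsP x; exists v; rewrite /D/= vx.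
have Dclosed : closed D.
  have -> : D = ((\bigcap_t (fun v : 'rV[R]_#|T| => coords v t) @^-1` [set y | 0 <= y]) `&`
      (\bigcap_j (fun v : 'rV[R]_#|T| => \sum_(t | cl t == j) coords v t) @^-1`
         [set y | y = 1]))%classic.
    apply/seteqP; split=> v [].
      by move=> v0 v1; split=> [t _|j _] /=.
    by move=> v0 v1; split=> [t|j]; [exact: v0 | exact: v1].
  apply: closedI; apply: closed_bigI => i _; apply: preimage_closed => //.
  - by move=> v _; exact: cic_coord.
  - by move=> v _; apply: (cic_sum (F := fun t x => x t)) => t; exact: cic_coord.
have Dcompact : compact D.
  have cube : compact [set v : 'rV[R]_#|T| | forall k, (v ord0 k \in `[(0 : R), 1])%R]%classic.
    apply: (@rV_compact _ _ (fun=> `[(0 : R), 1]%classic)) => _.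
    exact: segment_compact.
  apply: (subclosed_compact Dclosed cube).
  move=> v [v0 v1] k /=; rewrite in_itv/=.
  rewrite -(enum_valK k) -[v _ _]/(coords v (enum_val k)) v0/=.
  rewrite -(v1 (cl (enum_val k))) (bigD1 (enum_val k))//= lerDl.
  by apply: sumr_ge0 => t _; exact: v0.
(* twice the total positive part of the deficits [h i - F i x] *)
pose G (x : T -> R) := \sum_i ((h i - F i x) + `|h i - F i x|).
have cd i : continuous_in_coords (fun x => h i - F i x).
  exact: (@cic_add _ _ _ (@cic_cst _ (h i)) (@cic_opp _ _ (cF i))).
have cG : continuous_in_coords G.
  exact: (@cic_sum _ _ _ _ _ (fun i => @cic_add _ _ _ (cd i) (@cic_norm _ _ (cd i)))).
have [v /set_mem vD vmin] := compact_EVT_min D0 Dcompact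
  (continuous_subspaceT cG).
exists (coords v) => // i.
have pos x j : 0 <= (h j - F j x) + `|h j - F j x|.
  by rewrite -lerBlDl sub0r -normrN ler_norm.
have G0 : G (coords v) <= 0.
  apply/ler_addgt0Pl => e e0; rewrite addr0.
  pose N := #|I|%:R : R.
  (* Each of the [N] summands of [G] is at most twice the slack, for a total of e N / (N + 1) <= e;
     [N + 1] keeps the division valid when [I] is empty. *)
  have e' : 0 < e / (2 * (N + 1)).
    by rewrite divr_gt0// mulr_gt0// ltr_wpDl// ler0n.
  have [x xD hx] := hF _ e'; have [w wx] := coordsP x.
  have wD : w \in D by rewrite inE /D/= wx.
  apply: (le_trans (vmin w wD)); rewrite wx /G.
  apply: (@le_trans _ _ (\sum_(j : I) 2 * (e / (2 * (N + 1))))).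
    apply: ler_sum => j _; have := hx j; set d := e / _ in e' *.
    by case: (ler0P (h j - F j x)) => ? ?; lra.
  rewrite sumr_const -[leLHS]mulr_natl -/N.
  have N0 : 0 <= N by rewrite ler0n.
  rewrite [leLHS](_ : _ = e * (N / (N + 1))); last by field; lra.
  by rewrite -[leRHS]mulr1 ler_pM2l// ler_pdivrMr ?mul1r; lra.
have : (h i - F i (coords v)) + `|h i - F i (coords v)| <= 0.
  apply: le_trans G0; rewrite /G (bigD1 i)//= lerDl.
  by apply: sumr_ge0 => j _; exact: pos.
by case: (ler0P (h i - F i (coords v))) => ? ?; lra.
Qed.

End Compactness.

(** * The law of a code *)

Lemma fdist_card_gt0 (R : realType) (T : finType) : fdist R T -> (0 < #|T|)%N.
Proof.
move=> P; apply/card_gt0P; have [t _|T0] := pickP T; first by exists t.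
by have /eqP := pmf_sum1 P; rewrite big_pred0// eq_sym oner_eq0.
Qed.

Section CodeLaw.
Context {R : realType} {S1 S2 W W3 X1 X2 X3 Y Y3 : finType}.
Context (p : fdist R (S1 * S2 * W * W3)) (ch : marc_channel R X1 X2 X3 Y Y3).
Context {m n : nat} (c : code S1 S2 W W3 X1 X2 X3 Y Y3 m n).

Notation source := (S1 * S2 * W * W3)%type.
Notation sample := ({ffun 'I_m -> source} * {ffun 'I_n -> Y * Y3})%type.

Definition src1 (t : source) := t.1.1.1.
Definition src2 (t : source) := t.1.1.2.
Definition side (t : source) := t.1.2.
Definition side3 (t : source) := t.2.

Definition input (k : 'I_n) (o : sample) : X1 * X2 * X3 :=
  (enc1 c (letterwise src1 o.1) k, enc2 c (letterwise src2 o.1) k,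
   relay c (past (letterwise snd o.2) k) (letterwise side3 o.1)).

Definition channel (x : X1 * X2 * X3) : Y * Y3 -> R := ch x.1.1 x.1.2 x.2.

(* [code_law], transported by error_probE to blocks of joint letters. *)
Definition sample_law (o : sample) : R :=
  iid p o.1 * \prod_(k < n) channel (input k o) (o.2 k).

(** The finest past of use [k]: the blocks of both sources and of both side informations, with the
    past outputs of receiver and relay. It serves as the G_k of every bound. *)
Definition history (k : 'I_n) (o : sample) := (o.1, prefix o.2 k).

Lemma past_determines (k : 'I_n) (y y' : {ffun 'I_n -> Y3}) :
  (forall j : 'I_n, (j < k)%N -> y j = y' j) -> past y k = past y' k.
Proof. by move=> e; apply/ffunP => j; rewrite !ffunE; apply: e => /=. Qed.

Lemma history_input (k : 'I_n) : determines (history k) (input k).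
Proof.
move=> [t u] [t' u'] [-> /prefixP e]; rewrite /input/=; congr (_, relay _ _ _).
by apply: past_determines => j jk; rewrite !ffunE e.
Qed.

Lemma sample_law_ge0 o : 0 <= sample_law o.
Proof.
by rewrite mulr_ge0 ?iid_ge0// => [t|]; [|apply: prodr_ge0 => k _]; exact: pmf_ge0.
Qed.

Let kernel t (k : 'I_n) u b := channel (input k (t, u)) b.

Let kernel_causal t (k : 'I_n) : causal k (kernel t k).
Proof.
move=> u u' e; rewrite /kernel (@history_input k (t, u) (t, u'))//.
by congr (_, _); apply/prefixP.
Qed.

Let sum_kernel t k u : \sum_b kernel t k u b = 1.
Proof. exact: pmf_sum1. Qed.

(** For a fixed source block the outputs follow a product of causal kernels, and the indicator of an
    event decided by the history looks only at letters before [k], so [causal_channel] applies block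
    by block. *)
Lemma sample_law_channel (k : 'I_n) :
  channel_output sample_law (history k) (input k) (fun o => o.2 k) channel.
Proof.
move=> E HE b.
transitivity (\sum_t \sum_(u : {ffun 'I_n -> _} | u k == b)
    (iid p t * (E (t, u))%:R) * \prod_j kernel t j u (u j)).
  rewrite pair_big_dep/= [LHS]big_mkcond [RHS]big_mkcond/=.
  apply: eq_bigr => -[t u] _ /=; rewrite /sample_law/=.
  case: (E (t, u)) => /=; rewrite ?mulr1 ?mulr0 ?mul0r ?if_same//.
transitivity (\sum_t \sum_u
    (iid p t * (E (t, u))%:R) * kernel t k u b * \prod_j kernel t j u (u j)).
  apply: eq_bigr => t _; apply: causal_channel => // u u' e; congr (_ * _%:R).
  by rewrite (HE (t, u) (t, u'))//; congr (_, _); apply/prefixP.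
rewrite pair_big_dep/= [RHS]big_mkcond/=.
apply: eq_bigr => -[t u] _ /=; rewrite /sample_law/=.
by case: (E (t, u)); rewrite ?(mulr1, mulr0, mul0r)// mulrAC.
Qed.

Lemma sample_law_source : (0 < #|{: Y * Y3}|)%N ->
  forall t, iid p t = prob sample_law (fun o => o.1 == t).
Proof.
move=> B0 t; rewrite /prob.
transitivity (\sum_(t' | t' == t) \sum_u sample_law (t', u)).
  by rewrite big_pred1_eq /sample_law/= -mulr_sumr (sum_causal (@kernel_causal t))// mulr1.
by rewrite pair_big_dep/=; apply: eq_big => [[t' u]|[t' u]//]; rewrite andbT.
Qed.

Lemma sum_sample_law : (0 < #|{: Y * Y3}|)%N -> \sum_o sample_law o = 1.
Proof.
move=> B0; rewrite -(@sum_iid _ _ p m (pmf_sum1 p)).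
rewrite (partition_big fst xpredT)//=; apply: eq_bigr => t _.
by rewrite sample_law_source.
Qed.

Lemma error_probE : error_prob p ch c =
  prob sample_law (fun o => dec c (letterwise fst o.2) (letterwise side o.1)
                            != (letterwise src1 o.1, letterwise src2 o.1)).
Proof.
pose f (o : sample) : code_space S1 S2 W W3 Y Y3 m n :=
  (letterwise src1 o.1, letterwise src2 o.1, letterwise side o.1,
   letterwise side3 o.1, letterwise fst o.2, letterwise snd o.2).
pose g (z : code_space S1 S2 W W3 Y Y3 m n) : sample :=
  let '(s1, s2, w, w3, y, y3) := z in
  ([ffun j => (s1 j, s2 j, w j, w3 j)], [ffun j => (y j, y3 j)]).
have fK : cancel f g.
  move=> [t u]; rewrite /f /g/=; congr (_, _); apply/ffunP => j; rewrite !ffunE.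
    by case: (t j) => [[[]]].
  by case: (u j).
have gK : cancel g f.
  move=> [[[[[s1 s2] w] w3] y] y3]; rewrite /f /g/=.
  by congr (_, _, _, _, _, _); apply/ffunP => j; rewrite !ffunE.
rewrite /error_prob /prob (reindex f); last by exists g => z _; [exact: fK|exact: gK].
apply: eq_big => [//|o _]; rewrite /code_law /sample_law/=; congr (_ * _).
  apply: eq_bigr => j _; rewrite !ffunE; congr (p _).
  by case: (o.1 j) => [[[]]].
by apply: eq_bigr => k _; rewrite !ffunE /channel/=; case: (o.2 k).
Qed.

(** Divided by [m], this is ln 2 / m plus the error probability times a constant of the alphabets,
    hence small for long reliable codes. *)
Definition fano_bound : R :=
  ln 2 + error_prob p ch c * (m%:R * ln (#|S1|%:R * #|S2|%:R)).

Lemma marc_fano : (0 < #|{: Y * Y3}|)%N ->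
  cond_entropy sample_law
    (fun o => (letterwise src1 o.1, letterwise src2 o.1))
    (fun o => (letterwise fst o.2, letterwise side o.1)) <= fano_bound.
Proof.
move=> B0.
have S1_gt0 : (0 < #|S1|)%N.
  by have := fdist_card_gt0 p; rewrite !card_prod !muln_gt0 => /andP[/andP[/andP[]]].
have S2_gt0 : (0 < #|S2|)%N.
  by have := fdist_card_gt0 p; rewrite !card_prod !muln_gt0 => /andP[/andP[/andP[]]].
have := fano (fun o => (letterwise src1 o.1, letterwise src2 o.1))
  (fun o => (letterwise fst o.2, letterwise side o.1)) (fun z => dec c z.1 z.2)
  sample_law_ge0 (sum_sample_law B0).
rewrite /fano_bound error_probE card_prod !card_ffun card_ord -expnMn natrX.
rewrite lnXn ?ltr0n ?muln_gt0 ?S1_gt0//.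
by rewrite natrM [m%:R * _]mulr_natl.
Qed.

(** One statement for all six bounds: [f] selects the outputs seen across the cut and [gC] the
    letters conditioned on. Fano's inequality applies because [f] and [gC] contain the decoder's
    observations, and the decoded pair together with [gC] gives back [gA]. *)
Lemma single_letter (A C D B : finType) (gA : source -> A) (gC : source -> C)
    (f : Y * Y3 -> B) (DX : 'I_n -> sample -> D) : (0 < #|{: Y * Y3}|)%N ->
  determines gC side -> determines f fst ->
  determines (fun t => (src1 t, src2 t, gC t)) gA ->
  (forall k : 'I_n, determines
     (fun o => (prefix (letterwise f o.2) k, letterwise gC o.1)) (DX k)) ->
  m%:R * cond_entropy p gA gC <= fano_bound +
  \sum_(k < n) (cond_entropy sample_law (fun o => f (o.2 k)) (DX k) -
                cond_entropy sample_law (fun o => f (o.2 k)) (history k)).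
Proof.
move=> B0 hw hf hA hD.
(* Pairing with [gC] leaves the conditional entropy unchanged and makes [F] determine the
   conditioning variable, as [converse] requires. *)
pose F (o : sample) := (letterwise gA o.1, letterwise gC o.1).
rewrite -cond_entropy_iid; [|exact: pmf_ge0|exact: pmf_sum1].
rewrite (cond_entropy_pushforward _ _ (sample_law_source B0)).
have -> : cond_entropy sample_law (fun o => letterwise gA o.1)
    (fun o => letterwise gC o.1) =
    cond_entropy sample_law F (fun o => letterwise gC o.1).
  by apply: eq_cond_entropy; rewrite /F; try exact: sample_law_ge0; determine.
apply: le_trans (converse sample_law_ge0 (U := fun o => letterwise f o.2)
  (F := F) (DX := DX) (GX := fun k o => history k o) _ _ _) _; last first.
- apply: lerD; last first.
    have fE (A' : finType) (k : 'I_n) (V : sample -> A') :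
        cond_entropy sample_law (fun o => letterwise f o.2 k) V =
        cond_entropy sample_law (fun o => f (o.2 k)) V.
      by apply: eq_cond_entropy; try exact: sample_law_ge0; move=> o o'; rewrite ?ffunE//;
        case; rewrite ?ffunE.
    by under eq_bigr do rewrite !fE.
  apply: le_trans (marc_fano B0).
  apply: (@le_trans _ _ (cond_entropy sample_law
      (fun o => (letterwise src1 o.1, letterwise src2 o.1))
      (fun o => (letterwise f o.2, letterwise gC o.1)))).
    rewrite !cond_entropyE ?lerD2r; try exact: sample_law_ge0.
    apply: entropy_le; first exact: sample_law_ge0.
    move=> o o' [e1 e2 e3 e4]; rewrite /F e3 e4; congr (_, _, _).
    apply/ffunP => j; rewrite !ffunE; apply: hA.
    have /ffunP/(_ j) := e1; have /ffunP/(_ j) := e2; have /ffunP/(_ j) := e4.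
    by rewrite !ffunE => -> -> ->.
  apply: cond_entropy_determines; first exact: sample_law_ge0.
  by move=> o o' [/(letterwise_determines hf) -> /(letterwise_determines hw) ->].
- move=> k o o' [e1 /prefixP e2] /=; rewrite /F e1; congr (_, _).
  by apply/prefixP => j jk; rewrite !ffunE e2.
- by move=> k; exact: hD.
- by move=> o o' [].
Qed.

End CodeLaw.

Section JointLaw.
Context {R : realType} {Omega T : finType} (P : Omega -> R).
Context (P0 : forall o, 0 <= P o).
Context (P1 : \sum_o P o = 1).

Lemma prob_law_ge0 (X : Omega -> T) x : 0 <= prob P (fun o => X o == x).
Proof. by apply: sumr_ge0. Qed.

Lemma prob_law_sum1 (X : Omega -> T) : \sum_x prob P (fun o => X o == x) = 1.
Proof. by rewrite -P1 [RHS](partition_big X xpredT). Qed.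

Definition law_of (X : Omega -> T) : fdist R T :=
  FDist (prob_law_ge0 X) (prob_law_sum1 X).

End JointLaw.

Definition dirac_pmf (R : realType) (T : finType) (x y : T) : R := (y == x)%:R.

Lemma dirac_pmf_ge0 (R : realType) (T : finType) (x y : T) : 0 <= dirac_pmf R x y.
Proof. exact: ler0n. Qed.

Lemma dirac_pmf_sum1 (R : realType) (T : finType) (x : T) :
  \sum_y dirac_pmf R x y = 1.
Proof.
rewrite (bigD1 x)//= /dirac_pmf eqxx big1 ?addr0// => y /negbTE -> //.
Qed.

Definition dirac (R : realType) (T : finType) (x : T) : fdist R T :=
  FDist (dirac_pmf_ge0 R x) (dirac_pmf_sum1 R x).

Lemma cond_mutual_info_pushforward (R : realType) (Omega Omega' : finType)
    (P : Omega -> R) (Q : Omega' -> R) (Z : Omega -> Omega') (A B C : finType)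
    (X : Omega' -> A) (Y : Omega' -> B) (U : Omega' -> C) :
  (forall o, Q o = prob P (fun o' => Z o' == o)) ->
  cond_mutual_info Q X Y U = cond_mutual_info P (fun o => X (Z o))
    (fun o => Y (Z o)) (fun o => U (Z o)).
Proof. by move=> QE; rewrite /cond_mutual_info !(cond_entropy_pushforward _ _ QE). Qed.

Lemma cond_mutual_info_ge0 (R : realType) (Omega : finType) (P : Omega -> R)
    (A B C : finType) (X : Omega -> A) (Y : Omega -> B) (U : Omega -> C) :
  (forall o, 0 <= P o) -> 0 <= cond_mutual_info P X Y U.
Proof.
move=> P0; rewrite /cond_mutual_info subr_ge0; apply: cond_entropy_determines => //.
by move=> o o' [].
Qed.

(** Trivial conditioning gives the last bound of (i) the same shape as the other bounds. *)
Lemma mutual_info_unit (R : realType) (Omega : finType) (P : Omega -> R)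
    (A B : finType) (X : Omega -> A) (Y : Omega -> B) :
  (forall o, 0 <= P o) -> \sum_o P o = 1 ->
  mutual_info P X Y = cond_mutual_info P X Y (fun=> tt).
Proof.
move=> P0 P1; rewrite /mutual_info /cond_mutual_info; congr (_ - _).
  rewrite cond_entropyE// (@entropy_eq _ _ P _ _ (fun o => (X o, tt)) X)//; last 2 first.
  - by move=> o o' [].
  - by move=> o o' ->.
  rewrite [X in _ = _ - X]entropyE big1 => [|o _]; first by rewrite !oppr0 addr0.
  by rewrite /atom /prob (eq_bigl xpredT)// P1 ln1 mulr0.
by apply: eq_cond_entropy => //; determine.
Qed.

(** * The uniform time index *)

Section TimeSharing.
Context {R : realType} {S1 S2 W W3 X1 X2 X3 Y Y3 : finType}.
Context (p : fdist R (S1 * S2 * W * W3)) (ch : marc_channel R X1 X2 X3 Y Y3).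
Context {m n : nat} (c : code S1 S2 W W3 X1 X2 X3 Y Y3 m n).
Context (n0 : (0 < n)%N).
Context (B0 : (0 < #|{: Y * Y3}|)%N).

Notation source := (S1 * S2 * W * W3)%type.
Notation sample := ({ffun 'I_m -> source} * {ffun 'I_n -> Y * Y3})%type.

Definition shared_law : 'I_n * sample -> R :=
  mixture (fun=> n%:R^-1) (fun=> sample_law p ch c).

Definition shared_input (ko : 'I_n * sample) := input c ko.1 ko.2.
Definition shared_output (ko : 'I_n * sample) := ko.2.2 ko.1.
Definition shared_history (ko : 'I_n * sample) := (history ko.1 ko.2, ko.1).

Lemma shared_history_input : determines shared_history shared_input.
Proof.
move=> [k o] [k' o'] e; have /= e3 := congr1 snd e; have /= e1 := congr1 fst e.
by rewrite /shared_input /= e3; apply: history_input; rewrite -e1 e3.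
Qed.

Lemma shared_law_ge0 ko : 0 <= shared_law ko.
Proof.
by apply: mixture_ge0 => *; [rewrite invr_ge0 | exact: sample_law_ge0].
Qed.

Lemma sum_shared_law : \sum_ko shared_law ko = 1.
Proof.
rewrite sum_mixture => [|k]; last exact: sum_sample_law.
by rewrite sumr_const card_ord -[LHS]mulr_natl mulfV// pnatr_eq0 -lt0n.
Qed.

Lemma shared_law_channel :
  channel_output shared_law shared_history shared_input shared_output (channel ch).
Proof.
apply: (@channel_output_mixture _ _ _ _ _ _ _ _ history (input c) (fun k o => o.2 k)).
by move=> k; exact: sample_law_channel.
Qed.

(** The pair of [EX] and [DX] lies between the history and the channel input, so replacing the
    history by it leaves the output entropy unchanged. The other entropy, conditioned on [DX] and
    the index, can only grow when the index is dropped; if [DX] contains the index, nothing is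
    lost. *)
Lemma time_sharing (A C D B E : finType) (gA : source -> A) (gC : source -> C)
    (f : Y * Y3 -> B) (DX : 'I_n * sample -> D) (EX : 'I_n * sample -> E) :
  determines gC (@side S1 S2 W W3) -> determines f fst ->
  determines (fun t => (src1 t, src2 t, gC t)) gA ->
  (forall k : 'I_n, determines
     (fun o => (prefix (letterwise f o.2) k, letterwise gC o.1))
     (fun o => DX (k, o))) ->
  determines shared_history (fun ko => (EX ko, DX ko)) ->
  determines (fun ko => (EX ko, DX ko)) shared_input ->
  m%:R * cond_entropy p gA gC <= fano_bound p ch c +
  n%:R * cond_mutual_info shared_law EX (fun ko => f (shared_output ko)) DX.
Proof.
move=> hw hf hA hD hG Gi.
pose D' k o := DX (k, o).
pose fU (k : 'I_n) (o : sample) := f (o.2 k).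
apply: le_trans (single_letter p ch c (DX := D') B0 hw hf hA hD) _.
rewrite lerD2l.
have nR : n%:R != 0 :> R by rewrite pnatr_eq0 -lt0n.
have avg (F : 'I_n -> R) : \sum_k F k = n%:R * \sum_k n%:R^-1 * F k.
  by rewrite -mulr_sumr mulrA mulfV// mul1r.
rewrite avg ler_wpM2l//; under eq_bigr do rewrite mulrBr; rewrite sumrB.
have l0 (k : 'I_n) : 0 <= n%:R^-1 :> R by rewrite invr_ge0.
have P0 (k : 'I_n) := sample_law_ge0 p ch c.
rewrite -(cond_entropy_mixture fU D' l0 P0).
rewrite -(cond_entropy_mixture fU history l0 P0).
rewrite -/shared_law cond_mutual_infoE; last exact: shared_law_ge0.
apply: lerB.
  by apply: cond_entropy_determines; [exact: shared_law_ge0 | case=> k o [k' o'] []].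
have ch' := channel_output_map f shared_law_channel.
have := cond_entropy_channel_output shared_law_ge0 shared_history_input ch'.
rewrite (cond_entropy_channel_output shared_law_ge0 Gi (channel_output_determines hG ch')).
by move=> <-.
Qed.

End TimeSharing.

(** * The cut around the receiver and the cut around receiver and relay *)

Section CutSet.
Context {R : realType} {S1 S2 W W3 X1 X2 X3 Y Y3 : finType}.
Context (p : fdist R (S1 * S2 * W * W3)) (ch : marc_channel R X1 X2 X3 Y Y3).
Context {m n : nat} (c : code S1 S2 W W3 X1 X2 X3 Y Y3 m n).
Context (n0 : (0 < n)%N).
Context (B0 : (0 < #|{: Y * Y3}|)%N).

Notation source := (S1 * S2 * W * W3)%type.
Notation sample := ({ffun 'I_m -> source} * {ffun 'I_n -> Y * Y3})%type.
Notation slaw := (shared_law p ch c).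

Lemma law_X_ge0 (P : fdist R (X1 * X2 * X3)) z : 0 <= law_X P ch z.
Proof. by case: z => [[[[? ?] ?] ?] ?] /=; rewrite mulr_ge0// pmf_ge0. Qed.

Lemma sum_law_X (P : fdist R (X1 * X2 * X3)) : \sum_z law_X P ch z = 1.
Proof.
pose h (xb : X1 * X2 * X3 * (Y * Y3)) : X1 * X2 * X3 * Y * Y3 :=
  (xb.1.1.1, xb.1.1.2, xb.1.2, xb.2.1, xb.2.2).
rewrite (reindex h); last first.
  by exists (fun z => (z.1.1, (z.1.2, z.2))) =>
    [[[[x1 x2] x3] [y y3]]|[[[[x1 x2] x3] y] y3]] _.
rewrite -(pair_bigA _ (fun x b => law_X P ch (h (x, b))))/= -(pmf_sum1 P).
apply: eq_bigr => -[[x1 x2] x3] _ /=; rewrite -mulr_sumr.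
rewrite (eq_bigr (fun b => ch x1 x2 x3 b)) => [|[]//].
by rewrite pmf_sum1 mulr1.
Qed.

(** The conditioning variable is the input of the encoder whose source is conditioned on, a function
    of that source block alone, or is trivial in the last bound. All other inputs are counted as
    information across the cut. *)
Lemma cut_set_i : exists P : fdist R (X1 * X2 * X3),
  let q := law_X P ch in
  [/\ m%:R * cond_entropy p (fun '(s1, s2, w, w3) => s1)
                            (fun '(s1, s2, w, w3) => (s2, w))
      <= fano_bound p ch c + n%:R *
         cond_mutual_info q (fun '(x1, x2, x3, y, y3) => (x1, x3))
                            (fun '(x1, x2, x3, y, y3) => y)
                            (fun '(x1, x2, x3, y, y3) => x2),
      m%:R * cond_entropy p (fun '(s1, s2, w, w3) => s2)
                            (fun '(s1, s2, w, w3) => (s1, w))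
      <= fano_bound p ch c + n%:R *
         cond_mutual_info q (fun '(x1, x2, x3, y, y3) => (x2, x3))
                            (fun '(x1, x2, x3, y, y3) => y)
                            (fun '(x1, x2, x3, y, y3) => x1)
    & m%:R * cond_entropy p (fun '(s1, s2, w, w3) => (s1, s2))
                            (fun '(s1, s2, w, w3) => w)
      <= fano_bound p ch c + n%:R *
         mutual_info q (fun '(x1, x2, x3, y, y3) => (x1, x2, x3))
                       (fun '(x1, x2, x3, y, y3) => y)].
Proof.
pose X := shared_input c; pose B := @shared_output S1 S2 W W3 Y Y3 m n.
pose P := law_of (shared_law_ge0 p ch c) (sum_shared_law p ch c n0 B0) X.
exists P; cbv zeta.
pose Z ko := ((X ko).1.1, (X ko).1.2, (X ko).2, (B ko).1, (B ko).2).
have chan : channel_output slaw (@shared_history _ _ _ _ _ _ _ _) X B (channel ch).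
  exact: shared_law_channel.
have hX : determines (@shared_history S1 S2 W W3 Y Y3 m n) X.
  exact: shared_history_input.
have qE z : law_X P ch z = prob slaw (fun ko => Z ko == z).
  case: z => [[[[x1 x2] x3] y] y3] /=.
  transitivity (\sum_(ko | (X ko == (x1, x2, x3)) && (B ko == (y, y3))) slaw ko).
    rewrite (chan (fun ko => X ko == (x1, x2, x3))).
      rewrite /prob mulr_suml; apply: eq_bigr => ko /eqP e.
      by rewrite -/(X ko) e.
    by move=> o o' /hX e; rewrite e.
  apply: eq_bigl => ko; rewrite /Z; case: (X ko) (B ko) => [[a1 a2] a3] [b1 b2] /=.
  by rewrite !xpair_eqE !andbA.
have q0 := law_X_ge0 P; have q1 := sum_law_X P.
rewrite mutual_info_unit// !(cond_mutual_info_pushforward _ _ _ qE).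
split; apply: (@time_sharing R S1 S2 W W3 X1 X2 X3 Y Y3 p ch m n c n0 B0 _ _ _ _ _ _ _ fst) => //.
all: try by move=> [[[? ?] ?] ?] [[[? ?] ?] ?] /=; rewrite /src1 /src2 /side /=; congruence.
all: try by move=> o o' /hX; rewrite /Z => ->.
all: try by move=> o o'; rewrite /Z -/(X o) -/(X o');
  move: (X o) (X o') => [[? ?] ?] [[? ?] ?] /=; congruence.
- move=> k o o' [_ e] /=; congr (enc2 c _ k); apply: letterwise_determines e.
  by move=> [[[? ?] ?] ?] [[[? ?] ?] ?] [].
- move=> k o o' [_ e] /=; congr (enc1 c _ k); apply: letterwise_determines e.
  by move=> [[[? ?] ?] ?] [[[? ?] ?] ?] [].
Qed.

Lemma law_VX_ge0 (V : finType) (PV : fdist R V) (P12 : V -> fdist R (X1 * X2))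
    (P3 : V -> fdist R X3) z : 0 <= law_VX PV P12 P3 ch z.
Proof. by case: z => [[[[[? ?] ?] ?] ?] ?] /=; rewrite !mulr_ge0// pmf_ge0. Qed.

(** With [W3] conditioned on and [Y3] observed, [VX] is decided by the past outputs and the
    conditioning letters, so it may join the conditioning variable in all three bounds. The given
    letters only fill in conditional laws at values of [V] where they are arbitrary. *)
Lemma cut_set_ii (x1_0 : X1) (x2_0 : X2) (x3_0 : X3) :
  exists (V : finType) (PV : fdist R V) (P12 : V -> fdist R (X1 * X2))
         (P3 : V -> fdist R X3),
  let q := law_VX PV P12 P3 ch in
  [/\ m%:R * cond_entropy p (fun '(s1, s2, w, w3) => s1)
                            (fun '(s1, s2, w, w3) => (s2, w, w3))
      <= fano_bound p ch c + n%:R *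
         cond_mutual_info q (fun '(v, x1, x2, x3, y, y3) => x1)
                            (fun '(v, x1, x2, x3, y, y3) => (y, y3))
                            (fun '(v, x1, x2, x3, y, y3) => (x2, v)),
      m%:R * cond_entropy p (fun '(s1, s2, w, w3) => s2)
                            (fun '(s1, s2, w, w3) => (s1, w, w3))
      <= fano_bound p ch c + n%:R *
         cond_mutual_info q (fun '(v, x1, x2, x3, y, y3) => x2)
                            (fun '(v, x1, x2, x3, y, y3) => (y, y3))
                            (fun '(v, x1, x2, x3, y, y3) => (x1, v))
    & m%:R * cond_entropy p (fun '(s1, s2, w, w3) => (s1, s2))
                            (fun '(s1, s2, w, w3) => (w, w3))
      <= fano_bound p ch c + n%:R *
         cond_mutual_info q (fun '(v, x1, x2, x3, y, y3) => (x1, x2))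
                            (fun '(v, x1, x2, x3, y, y3) => (y, y3))
                            (fun '(v, x1, x2, x3, y, y3) => v)].
Proof.
pose X := shared_input c; pose B := @shared_output S1 S2 W W3 Y Y3 m n.
pose hist := @shared_history S1 S2 W W3 Y Y3 m n.
(* The paper's V: time index, past relay outputs and relay side information;
   the relay input is a function of it. *)
pose VX (ko : 'I_n * sample) :=
  (ko.1, (prefix (letterwise snd ko.2.2) ko.1, letterwise (@side3 S1 S2 W W3) ko.2.1)).
pose VT : finType := ('I_n * ({ffun 'I_n -> option Y3} * {ffun 'I_m -> W3}))%type.
have P0 := shared_law_ge0 p ch c.
have P1 := sum_shared_law p ch c n0 B0.
have chan : channel_output slaw hist X B (channel ch) by exact: shared_law_channel.
have hX : determines hist X by exact: shared_history_input.
have hV : determines hist VX.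
  move=> [k [t u]] [k' [t' u']] e; have /= ek := congr1 snd e; subst k'.
  move: e => [-> /prefixP e]; rewrite /VX/=; congr (_, (_, _)).
  by apply/prefixP => j jk; rewrite !ffunE e.
have VX3 : determines VX (fun ko => (X ko).2).
  move=> [k [t u]] [k' [t' u']] e; have /= ek := congr1 fst e; subst k'.
  move: e => [/prefixP e ew].
  by rewrite /X /shared_input /input /= ew; congr (relay _ _ _); exact: past_determines.
have hVk (C : finType) (gC : source -> C) (k : 'I_n) o o' :
    determines gC (@side3 S1 S2 W W3) ->
    (prefix (letterwise id o.2) k, letterwise gC o.1) =
    (prefix (letterwise id o'.2) k, letterwise gC o'.1) -> VX (k, o) = VX (k, o').
  move=> h [/prefixP e1 /(letterwise_determines h) e2]; rewrite /VX/= e2.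
  congr (_, (_, _)); apply/prefixP => j jk.
  by have := e1 j jk; rewrite !ffunE => ->.
have key o o' : (X o).1.1 = (X o').1.1 -> (X o).1.2 = (X o').1.2 ->
    VX o = VX o' -> X o = X o'.
  move=> e1 e2 /VX3; case: (X o) (X o') e1 e2 => [[? ?] ?] [[? ?] ?] /=; congruence.
pose PV := law_of P0 P1 (VX : _ -> VT).
pose PVX := law_of P0 P1 (fun ko => (VX ko : VT, (X ko).1)).
(* The relay input as a function of [v], which makes p(x3|v) a point mass; [x3_0] is the value at
   those [v] that [VX] never takes. *)
pose x3 (v : VT) : X3 := if [pick ko | VX ko == v] is Some ko then (X ko).2 else x3_0.
have x3E ko : x3 (VX ko) = (X ko).2.
  rewrite /x3; case: pickP => [ko' /eqP e|/(_ ko)]; last by rewrite eqxx.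
  exact: VX3 e.
(* The conditional law of the two encoder inputs; at null [v] a point mass keeps it a distribution,
   since the quotient would be 0 everywhere. *)
pose c12 (v : VT) (x : X1 * X2) : R :=
  if PV v == 0 then dirac R (x1_0, x2_0) x else PVX (v, x) / PV v.
have c12_ge0 v x : 0 <= c12 v x.
  by rewrite /c12; case: ifP => _; rewrite ?divr_ge0// pmf_ge0.
have sumPVX v : \sum_x PVX (v, x) = PV v.
  rewrite /= /prob [RHS](partition_big (fun ko => (X ko).1) xpredT)//=.
have c12_sum v : \sum_x c12 v x = 1.
  rewrite /c12; have [_|h] := eqVneq (PV v) 0; first exact: pmf_sum1.
  by rewrite -mulr_suml sumPVX mulfV.
pose P12 v := FDist (c12_ge0 v) (c12_sum v).
pose P3 v := dirac R (x3 v).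
exists VT, PV, P12, P3; cbv zeta.
pose Z ko := (VX ko, (X ko).1.1, (X ko).1.2, (X ko).2, (B ko).1, (B ko).2).
have PVP12 v x : PV v * P12 v x = PVX (v, x).
  rewrite [P12 v x]/(c12 v x) /c12; have [h|h] := eqVneq (PV v) 0; last by rewrite mulrC divfK.
  rewrite h mul0r; apply/esym/le_anti; rewrite pmf_ge0 andbT -h -sumPVX.
  by rewrite (bigD1 x)//= lerDl; apply: sumr_ge0 => x' _; exact: (pmf_ge0 PVX (v, x')).
have qE z : law_VX PV P12 P3 ch z = prob slaw (fun ko => Z ko == z).
  case: z => [[[[[v a1] a2] a3] y] y3].
  transitivity (PVX (v, (a1, a2)) * P3 v a3 * ch a1 a2 a3 (y, y3)).
    by rewrite -PVP12.
  transitivity (\sum_(ko | ((VX ko == v) && (X ko == (a1, a2, a3))) && (B ko == (y, y3))) slaw ko).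
    rewrite (chan (fun ko => (VX ko == v) && (X ko == (a1, a2, a3)))); last first.
      by move=> o o' e; rewrite (hX _ _ e) (hV _ _ e).
    rewrite /= {1}/prob !mulr_suml [LHS]big_mkcond [RHS]big_mkcond/=.
    apply: eq_bigr => ko _; rewrite xpair_eqE -/(X ko) /dirac_pmf.
    case: (VX ko =P v) => //= <-; rewrite x3E.
    case EX: (X ko) => [[b1 b2] b3]; case: (EX) => -> -> _.
    rewrite !xpair_eqE /channel/=.
    case: (b1 =P a1) => //= ->; case: (b2 =P a2) => //= ->.
    by rewrite eq_sym; case: (b3 =P a3) => [->|]; rewrite ?mulr1// mulr0 mul0r.
  apply: eq_bigl => ko; rewrite /Z; case: (X ko) (B ko) => [[b1 b2] b3] [d1 d2] /=.
  by rewrite !xpair_eqE !andbA.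
rewrite !(cond_mutual_info_pushforward _ _ _ qE).
split; apply: (@time_sharing R S1 S2 W W3 X1 X2 X3 Y Y3 p ch m n c n0 B0 _ _ _ _ _ _ _ id) => //.
all: try by move=> [[[? ?] ?] ?] [[[? ?] ?] ?] /=; rewrite /src1 /src2 /side /=; congruence.
all: try by move=> o o' e; rewrite /Z (hX _ _ e) (hV _ _ e).
- by move=> o o' /= ->.
- move=> k o o' e; have /= h : VX (k, o) = VX (k, o').
    by apply: hVk e => -[[[? ?] ?] ?] [[[? ?] ?] ?] [].
  rewrite /Z h; congr (enc2 c _ k, _); case: e => _; apply: letterwise_determines.
  by move=> [[[? ?] ?] ?] [[[? ?] ?] ?] [].
- move=> o o' e; exact: (key o o' (congr1 fst e) (congr1 (fun z => z.2.1) e)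
    (congr1 (fun z => z.2.2) e)).
- by move=> o o' /= ->.
- move=> k o o' e; have /= h : VX (k, o) = VX (k, o').
    by apply: hVk e => -[[[? ?] ?] ?] [[[? ?] ?] ?] [].
  rewrite /Z h; congr (enc1 c _ k, _); case: e => _; apply: letterwise_determines.
  by move=> [[[? ?] ?] ?] [[[? ?] ?] ?] [].
- move=> o o' e; exact: (key o o' (congr1 (fun z => z.2.1) e) (congr1 fst e)
    (congr1 (fun z => z.2.2) e)).
- by move=> o o' /= ->.
- move=> k o o' e; apply: hVk e => -[[[? ?] ?] ?] [[[? ?] ?] ?].
  by rewrite /side3 /=; congruence.
- move=> o o' e; exact: (key o o' (congr1 (fun z => z.1.1) e)
    (congr1 (fun z => z.1.2) e) (congr1 snd e)).
Qed.

End CutSet.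

(** * Bounding the auxiliary alphabet and passing to the limit *)

Lemma cond_mutual_info_mixture (R : realType) (K Omega A B C : finType)
    (l : K -> R) (P : K -> Omega -> R) (X : K -> Omega -> A)
    (Y : K -> Omega -> B) (U : K -> Omega -> C) :
  (forall k, 0 <= l k) -> (forall k o, 0 <= P k o) ->
  cond_mutual_info (mixture l P) (fun ko => X ko.1 ko.2) (fun ko => Y ko.1 ko.2)
    (fun ko => (U ko.1 ko.2, ko.1)) =
  \sum_k l k * cond_mutual_info (P k) (X k) (Y k) (U k).
Proof.
move=> l0 P0; have m0 := mixture_ge0 l0 P0.
under eq_bigr do rewrite /cond_mutual_info mulrBr; rewrite sumrB.
rewrite -(cond_entropy_mixture X U l0 P0).
rewrite -(cond_entropy_mixture X (fun k o => (Y k o, U k o)) l0 P0).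
by congr (_ - _); apply: eq_cond_entropy => //; determine.
Qed.

Section ProductLaw.
Context {R : realType} {A B : finType} (P : fdist R A) (Q : fdist R B).

Let prod_pmf (x : A * B) : R := P x.1 * Q x.2.

Let prod_pmf_ge0 x : 0 <= prod_pmf x.
Proof. by rewrite mulr_ge0// pmf_ge0. Qed.

Let prod_pmf_sum1 : \sum_x prod_pmf x = 1.
Proof.
rewrite -(pair_bigA _ (fun a b => P a * Q b))/= -(pmf_sum1 P).
by apply: eq_bigr => a _; rewrite -mulr_sumr pmf_sum1 mulr1.
Qed.

Definition fdist_prod : fdist R (A * B) := FDist prod_pmf_ge0 prod_pmf_sum1.

End ProductLaw.

Section Reduction.
Context {R : realType} {X1 X2 X3 Y Y3 : finType} (ch : marc_channel R X1 X2 X3 Y Y3).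

Section Mixed.
Context {V : finType} (PV : fdist R V) (P12 : V -> fdist R (X1 * X2))
  (P3 : V -> fdist R X3).

Let slice v := law_X (fdist_prod (P12 v) (P3 v)) ch.
Let Z (vz : V * (X1 * X2 * X3 * Y * Y3)) :=
  (vz.1, vz.2.1.1.1.1, vz.2.1.1.1.2, vz.2.1.1.2, vz.2.1.2, vz.2.2).

Let law_VXE z : law_VX PV P12 P3 ch z = prob (mixture PV slice) (fun vz => Z vz == z).
Proof.
case: z => [[[[[v x1] x2] x3] y] y3].
rewrite /prob (big_pred1 (v, (x1, x2, x3, y, y3))) => [|[v' [[[[x1' x2'] x3'] y'] y3']]].
  by rewrite /mixture /=; ring.
by rewrite /Z /= !xpair_eqE !andbA.
Qed.

(** Given [v], the inputs have a product law, so [law_VX] is a mixture of its slices. An information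
    conditioned on [v] is thus linear in [PV], the form that Caratheodory's theorem needs. *)
Lemma cond_mutual_info_law_VX (A B C : finType)
    (a : V * X1 * X2 * X3 * Y * Y3 -> A) (b : V * X1 * X2 * X3 * Y * Y3 -> B)
    (u : V * X1 * X2 * X3 * Y * Y3 -> C) (a' : X1 * X2 * X3 * Y * Y3 -> A)
    (b' : X1 * X2 * X3 * Y * Y3 -> B) (u' : X1 * X2 * X3 * Y * Y3 -> C) :
  (forall vz, a (Z vz) = a' vz.2) -> (forall vz, b (Z vz) = b' vz.2) ->
  (forall vz, u (Z vz) = u' vz.2) ->
  cond_mutual_info (law_VX PV P12 P3 ch) a b (fun z => (u z, z.1.1.1.1.1)) =
  \sum_v PV v * cond_mutual_info (law_X (fdist_prod (P12 v) (P3 v)) ch) a' b' u'.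
Proof.
move=> ha hb hu; rewrite (cond_mutual_info_pushforward _ _ _ law_VXE).
have s0 v z : 0 <= slice v z by exact: law_X_ge0.
rewrite -(cond_mutual_info_mixture (fun=> a') (fun=> b') (fun=> u') (pmf_ge0 PV) s0).
have m0 := mixture_ge0 (pmf_ge0 PV) s0.
rewrite /cond_mutual_info; congr (_ - _); apply: eq_cond_entropy => // o o';
  rewrite ?ha ?hb ?hu /=; congruence.
Qed.

End Mixed.

(** Only three numbers are preserved, not the input law, so 3 + 1 values suffice. Each retained
    value keeps its own pair of conditional laws, hence the product form. *)
Lemma time_sharing_cardinality (V : finType) (PV : fdist R V)
    (P12 : V -> fdist R (X1 * X2)) (P3 : V -> fdist R X3) :
  exists (QV : fdist R 'I_4) (Q12 : 'I_4 -> fdist R (X1 * X2))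
         (Q3 : 'I_4 -> fdist R X3),
  let p := law_VX PV P12 P3 ch in let q := law_VX QV Q12 Q3 ch in
  [/\ cond_mutual_info q (fun '(v, x1, x2, x3, y, y3) => x1)
                         (fun '(v, x1, x2, x3, y, y3) => (y, y3))
                         (fun '(v, x1, x2, x3, y, y3) => (x2, v)) =
      cond_mutual_info p (fun '(v, x1, x2, x3, y, y3) => x1)
                         (fun '(v, x1, x2, x3, y, y3) => (y, y3))
                         (fun '(v, x1, x2, x3, y, y3) => (x2, v)),
      cond_mutual_info q (fun '(v, x1, x2, x3, y, y3) => x2)
                         (fun '(v, x1, x2, x3, y, y3) => (y, y3))
                         (fun '(v, x1, x2, x3, y, y3) => (x1, v)) =
      cond_mutual_info p (fun '(v, x1, x2, x3, y, y3) => x2)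
                         (fun '(v, x1, x2, x3, y, y3) => (y, y3))
                         (fun '(v, x1, x2, x3, y, y3) => (x1, v))
    & cond_mutual_info q (fun '(v, x1, x2, x3, y, y3) => (x1, x2))
                         (fun '(v, x1, x2, x3, y, y3) => (y, y3))
                         (fun '(v, x1, x2, x3, y, y3) => v) =
      cond_mutual_info p (fun '(v, x1, x2, x3, y, y3) => (x1, x2))
                         (fun '(v, x1, x2, x3, y, y3) => (y, y3))
                         (fun '(v, x1, x2, x3, y, y3) => v)].
Proof.
pose yy (z : X1 * X2 * X3 * Y * Y3) := (z.1.2, z.2).
pose s v := law_X (fdist_prod (P12 v) (P3 v)) ch.
pose f (v : V) (i : 'I_3) : R := nth 0
  [:: cond_mutual_info (s v) (fun z => z.1.1.1.1) yy (fun z => z.1.1.1.2);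
      cond_mutual_info (s v) (fun z => z.1.1.1.2) yy (fun z => z.1.1.1.1);
      cond_mutual_info (s v) (fun z => z.1.1.1) yy (fun=> tt)] i.
have [e [mu [mu0 mu1 muf]]] := caratheodory f (pmf_ge0 PV) (pmf_sum1 PV).
pose QV := FDist mu0 mu1.
have first_ U (PU : fdist R U) Q12 Q3 : cond_mutual_info (law_VX PU Q12 Q3 ch)
    (fun '(v, x1, x2, x3, y, y3) => x1) (fun '(v, x1, x2, x3, y, y3) => (y, y3))
    (fun '(v, x1, x2, x3, y, y3) => (x2, v)) =
    \sum_v PU v * cond_mutual_info (law_X (fdist_prod (Q12 v) (Q3 v)) ch)
      (fun z => z.1.1.1.1) yy (fun z => z.1.1.1.2).
  rewrite -(@cond_mutual_info_law_VX _ PU Q12 Q3 _ _ _ (fun z => z.1.1.1.1.2)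
    (fun z => (z.1.2, z.2)) (fun z => z.1.1.1.2))//.
  have q0 := law_VX_ge0 ch PU Q12 Q3.
  by rewrite /cond_mutual_info; congr (_ - _); apply: eq_cond_entropy => //;
    move=> [[[[[? ?] ?] ?] ?] ?] [[[[[? ?] ?] ?] ?] ?] /=; congruence.
have second_ U (PU : fdist R U) Q12 Q3 : cond_mutual_info (law_VX PU Q12 Q3 ch)
    (fun '(v, x1, x2, x3, y, y3) => x2) (fun '(v, x1, x2, x3, y, y3) => (y, y3))
    (fun '(v, x1, x2, x3, y, y3) => (x1, v)) =
    \sum_v PU v * cond_mutual_info (law_X (fdist_prod (Q12 v) (Q3 v)) ch)
      (fun z => z.1.1.1.2) yy (fun z => z.1.1.1.1).
  rewrite -(@cond_mutual_info_law_VX _ PU Q12 Q3 _ _ _ (fun z => z.1.1.1.2)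
    (fun z => (z.1.2, z.2)) (fun z => z.1.1.1.1.2))//.
  have q0 := law_VX_ge0 ch PU Q12 Q3.
  by rewrite /cond_mutual_info; congr (_ - _); apply: eq_cond_entropy => //;
    move=> [[[[[? ?] ?] ?] ?] ?] [[[[[? ?] ?] ?] ?] ?] /=; congruence.
have third_ U (PU : fdist R U) Q12 Q3 : cond_mutual_info (law_VX PU Q12 Q3 ch)
    (fun '(v, x1, x2, x3, y, y3) => (x1, x2))
    (fun '(v, x1, x2, x3, y, y3) => (y, y3)) (fun '(v, x1, x2, x3, y, y3) => v) =
    \sum_v PU v * cond_mutual_info (law_X (fdist_prod (Q12 v) (Q3 v)) ch)
      (fun z => z.1.1.1) yy (fun=> tt).
  rewrite -(@cond_mutual_info_law_VX _ PU Q12 Q3 _ _ _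
    (fun z => (z.1.1.1.1.2, z.1.1.1.2)) (fun z => (z.1.2, z.2)) (fun=> tt))//.
    have q0 := law_VX_ge0 ch PU Q12 Q3.
    by rewrite /cond_mutual_info; congr (_ - _); apply: eq_cond_entropy => //;
      move=> [[[[[? ?] ?] ?] ?] ?] [[[[[? ?] ?] ?] ?] ?] /=; congruence.
  by move=> [? [[[[? ?] ?] ?] ?]].
exists QV, (fun j => P12 (e j)), (fun j => P3 (e j)); cbv zeta.
rewrite !first_ !second_ !third_; split.
- exact: (muf (@Ordinal 3 0 isT)).
- exact: (muf (@Ordinal 3 1 isT)).
- exact: (muf (@Ordinal 3 2 isT)).
Qed.

End Reduction.

(** The quotient inside [cond_entropy] is not continuous where its denominator vanishes, whereas
    plain entropies are continuous everywhere. The signs are written as [cic_add] and [cic_opp]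
    produce them. *)
Lemma cond_mutual_info_entropies (R : realType) (Omega A B C : finType)
    (P : Omega -> R) (X : Omega -> A) (Y : Omega -> B) (U : Omega -> C) :
  (forall o, 0 <= P o) ->
  cond_mutual_info P X Y U =
  entropy P (fun o => (X o, U o)) + - entropy P U +
  - (entropy P (fun o => (X o, (Y o, U o))) + - entropy P (fun o => (Y o, U o))).
Proof. by move=> P0; rewrite /cond_mutual_info !cond_entropyE. Qed.

Lemma cic_cond_mutual_info (R : realType) (T Omega A B C : finType)
    (q : (T -> R) -> Omega -> R) (X : Omega -> A) (Y : Omega -> B) (U : Omega -> C)
    (kappa : R) :
  (forall o, continuous_in_coords (q^~ o)) ->
  continuous_in_coords (fun x => kappa *
    (entropy (q x) (fun o => (X o, U o)) + - entropy (q x) U +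
     - (entropy (q x) (fun o => (X o, (Y o, U o))) +
        - entropy (q x) (fun o => (Y o, U o))))).
Proof.
move=> cq; have ce (D : finType) (V : Omega -> D) := @cic_entropy R T Omega D q V cq.
apply: (@cic_mul _ _ (fun=> kappa) _ (@cic_cst _ _ kappa)).
apply: (@cic_add _ _ _ _ (@cic_add _ _ _ _ (ce _ _) (@cic_opp _ _ _ (ce _ _)))).
exact: (@cic_opp _ _ _ (@cic_add _ _ _ _ (ce _ _) (@cic_opp _ _ _ (ce _ _)))).
Qed.

Section Limit.
Context {R : realType} {X1 X2 X3 Y Y3 : finType} (ch : marc_channel R X1 X2 X3 Y Y3).
Context (kappa : R).

Lemma limit_law_X (A1 A2 A3 B U1 U2 U3 : finType) (h1 h2 h3 : R)
    (a1 : X1 * X2 * X3 * Y * Y3 -> A1) (a2 : X1 * X2 * X3 * Y * Y3 -> A2)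
    (a3 : X1 * X2 * X3 * Y * Y3 -> A3) (b : X1 * X2 * X3 * Y * Y3 -> B)
    (u1 : X1 * X2 * X3 * Y * Y3 -> U1) (u2 : X1 * X2 * X3 * Y * Y3 -> U2)
    (u3 : X1 * X2 * X3 * Y * Y3 -> U3) :
  (forall e, 0 < e -> exists P : fdist R (X1 * X2 * X3), let q := law_X P ch in
    [/\ h1 <= kappa * cond_mutual_info q a1 b u1 + e,
        h2 <= kappa * cond_mutual_info q a2 b u2 + e
      & h3 <= kappa * cond_mutual_info q a3 b u3 + e]) ->
  exists P : fdist R (X1 * X2 * X3), let q := law_X P ch in
    [/\ h1 <= kappa * cond_mutual_info q a1 b u1,
        h2 <= kappa * cond_mutual_info q a2 b u2
      & h3 <= kappa * cond_mutual_info q a3 b u3].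
Proof.
move=> H.
pose q (x : X1 * X2 * X3 -> R) : X1 * X2 * X3 * Y * Y3 -> R :=
  fun '(x1, x2, x3, y, y3) => x (x1, x2, x3) * ch x1 x2 x3 (y, y3).
have cq z : continuous_in_coords (q^~ z).
  case: z => [[[[x1 x2] x3] y] y3].
  exact: (@cic_mul _ _ _ _ (@cic_coord _ _ _) (@cic_cst _ _ (ch x1 x2 x3 (y, y3)))).
pose cmi (A U : finType) (a : X1 * X2 * X3 * Y * Y3 -> A)
    (u : X1 * X2 * X3 * Y * Y3 -> U) x := kappa *
  (entropy (q x) (fun o => (a o, u o)) + - entropy (q x) u +
   - (entropy (q x) (fun o => (a o, (b o, u o))) + - entropy (q x) (fun o => (b o, u o)))).
pose F (i : 'I_3) := nth (cmi _ _ a3 u3) [:: cmi _ _ a1 u1; cmi _ _ a2 u2] i.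
pose h (i : 'I_3) := nth h3 [:: h1; h2] i.
have cF i : continuous_in_coords (F i).
  by case: i => [[|[|i]] hi]; rewrite /F /= ?nth_nil; exact: cic_cond_mutual_info.
have [|x [x0 x1] hx] := @simplices_limit R _ unit _ (fun=> tt) F h cF.
  move=> e /H[P [H1 H2 H3]]; exists P.
    split=> [t|[]]; first exact: pmf_ge0.
    by rewrite -[RHS](pmf_sum1 P); apply: eq_bigl.
  have q0 := law_X_ge0 ch P.
  by case=> [[|[|[|//]]] hi]; rewrite /F /h /= /cmi -cond_mutual_info_entropies.
have x1' : \sum_t x t = 1 by rewrite -(x1 tt); apply: eq_bigl.
exists (FDist x0 x1'); cbv zeta; have q0 := law_X_ge0 ch (FDist x0 x1').
rewrite !cond_mutual_info_entropies//; split.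
- exact: (hx (@Ordinal 3 0 isT)).
- exact: (hx (@Ordinal 3 1 isT)).
- exact: (hx (@Ordinal 3 2 isT)).
Qed.

Lemma limit_law_VX (V A1 A2 A3 B U1 U2 U3 : finType) (h1 h2 h3 : R)
    (a1 : V * X1 * X2 * X3 * Y * Y3 -> A1) (a2 : V * X1 * X2 * X3 * Y * Y3 -> A2)
    (a3 : V * X1 * X2 * X3 * Y * Y3 -> A3) (b : V * X1 * X2 * X3 * Y * Y3 -> B)
    (u1 : V * X1 * X2 * X3 * Y * Y3 -> U1) (u2 : V * X1 * X2 * X3 * Y * Y3 -> U2)
    (u3 : V * X1 * X2 * X3 * Y * Y3 -> U3) :
  (forall e, 0 < e -> exists (PV : fdist R V) (P12 : V -> fdist R (X1 * X2))
      (P3 : V -> fdist R X3), let q := law_VX PV P12 P3 ch in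
    [/\ h1 <= kappa * cond_mutual_info q a1 b u1 + e,
        h2 <= kappa * cond_mutual_info q a2 b u2 + e
      & h3 <= kappa * cond_mutual_info q a3 b u3 + e]) ->
  exists (PV : fdist R V) (P12 : V -> fdist R (X1 * X2))
      (P3 : V -> fdist R X3), let q := law_VX PV P12 P3 ch in
    [/\ h1 <= kappa * cond_mutual_info q a1 b u1,
        h2 <= kappa * cond_mutual_info q a2 b u2
      & h3 <= kappa * cond_mutual_info q a3 b u3].
Proof.
move=> H.
(* One coordinate for each value of [PV], of every [P12 v] and of every [P3 v]; the classes of [cl]
   are these separate laws, and [q] below is polynomial in the coordinates. *)
pose T : finType := (V + V * (X1 * X2) + V * X3)%type.
pose cl (t : T) : option (V + V) := match t with
  | inl (inl v) => None | inl (inr va) => Some (inl va.1) | inr va => Some (inr va.1) end.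
have sum_pair (A : finType) (g : V * A -> R) v :
    \sum_(va | va.1 == v) g va = \sum_a g (v, a).
  transitivity (\sum_(v' | v' == v) \sum_a g (v', a)); last by rewrite big_pred1_eq.
  by rewrite pair_big_dep/=; apply: eq_big => [[v' a]|[v' a]//]; rewrite andbT.
have sumT (x : T -> R) : (forall j, \sum_(t | cl t == j) x t =
    match j with
    | None => \sum_v x (inl (inl v))
    | Some (inl v) => \sum_a x (inl (inr (v, a)))
    | Some (inr v) => \sum_a x (inr (v, a)) end).
  move=> j; rewrite !big_sumType/=; case: j => [[v|v]|] /=.
  - by rewrite big_pred0// add0r [X in _ + X]big_pred0// addr0 sum_pair.
  - by rewrite big_pred0// add0r big_pred0// add0r sum_pair.
  - by rewrite [X in _ + X]big_pred0// addr0 [X in _ + X]big_pred0// addr0.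
pose q (x : T -> R) : V * X1 * X2 * X3 * Y * Y3 -> R := fun '(v, x1, x2, x3, y, y3) =>
  x (inl (inl v)) * x (inl (inr (v, (x1, x2)))) * x (inr (v, x3)) * ch x1 x2 x3 (y, y3).
have cq z : continuous_in_coords (q^~ z).
  case: z => [[[[[v x1] x2] x3] y] y3].
  apply: (@cic_mul _ _ _ _ _ (@cic_cst _ _ (ch x1 x2 x3 (y, y3)))).
  apply: (@cic_mul _ _ _ _ _ (@cic_coord _ _ _)).
  exact: (@cic_mul _ _ _ _ (@cic_coord _ _ _) (@cic_coord _ _ _)).
pose cmi (A U : finType) (a : V * X1 * X2 * X3 * Y * Y3 -> A)
    (u : V * X1 * X2 * X3 * Y * Y3 -> U) x := kappa *
  (entropy (q x) (fun o => (a o, u o)) + - entropy (q x) u +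
   - (entropy (q x) (fun o => (a o, (b o, u o))) + - entropy (q x) (fun o => (b o, u o)))).
pose F (i : 'I_3) := nth (cmi _ _ a3 u3) [:: cmi _ _ a1 u1; cmi _ _ a2 u2] i.
pose h (i : 'I_3) := nth h3 [:: h1; h2] i.
have cF i : continuous_in_coords (F i).
  by case: i => [[|[|i]] hi]; rewrite /F /= ?nth_nil; exact: cic_cond_mutual_info.
have [|x [x0 x1] hx] := @simplices_limit R _ _ _ cl F h cF.
  move=> e /H[PV [P12 [P3 [H1 H2 H3]]]].
  exists (fun t : T => match t with inl (inl v) => PV v
    | inl (inr va) => P12 va.1 va.2 | inr va => P3 va.1 va.2 end).
    split=> [[[v|va]|va]|j]; try exact: pmf_ge0.
    rewrite sumT; case: j => [[v|v]|].
    - exact: (pmf_sum1 (P12 v)).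
    - exact: (pmf_sum1 (P3 v)).
    - exact: (pmf_sum1 PV).
  have q0 := law_VX_ge0 ch PV P12 P3.
  by case=> [[|[|[|//]]] hi]; rewrite /F /h /= /cmi -[q _]/(law_VX PV P12 P3 ch)
    -cond_mutual_info_entropies.
pose PV := FDist (fun v => x0 (inl (inl v))) (etrans (esym (sumT x None)) (x1 None)).
pose P12 v := FDist (fun a => x0 (inl (inr (v, a))))
  (etrans (esym (sumT x (Some (inl v)))) (x1 (Some (inl v)))).
pose P3 v := FDist (fun a => x0 (inr (v, a)))
  (etrans (esym (sumT x (Some (inr v)))) (x1 (Some (inr v)))).
exists PV, P12, P3; cbv zeta; have q0 := law_VX_ge0 ch PV P12 P3.
rewrite !cond_mutual_info_entropies//; split.
- exact: (hx (@Ordinal 3 0 isT)).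
- exact: (hx (@Ordinal 3 1 isT)).
- exact: (hx (@Ordinal 3 2 isT)).
Qed.

End Limit.

(** * From reliable codes to bounds per source letter *)

Section NoChannelUse.
Context {R : realType} {S1 S2 W W3 X1 X2 X3 Y Y3 : finType}.
Context (p : fdist R (S1 * S2 * W * W3)) (ch : marc_channel R X1 X2 X3 Y Y3).

(** The sum over channel uses is empty, so the source entropy is bounded by the Fano term alone, and
    [I] may be any number. *)
Lemma no_channel_use (m n : nat) (c : code S1 S2 W W3 X1 X2 X3 Y Y3 m n)
    (A C : finType) (gA : S1 * S2 * W * W3 -> A) (gC : S1 * S2 * W * W3 -> C) (I : R) :
  n = 0 -> (0 < #|{: Y * Y3}|)%N -> determines gC (@side S1 S2 W W3) ->
  determines (fun t => (src1 t, src2 t, gC t)) gA ->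
  m%:R * cond_entropy p gA gC <= fano_bound p ch c + n%:R * I.
Proof.
move=> n0 B0 hw hA.
have := @single_letter _ _ _ _ _ _ _ _ _ _ p ch m n c _ _ unit _ gA gC id
  (fun _ _ => tt) B0 hw _ hA _.
by move/(_ (fun _ _ e => congr1 fst e) (fun _ _ _ _ => erefl)); subst n; rewrite big_ord0 mul0r.
Qed.

End NoChannelUse.

Lemma achievable_approx (R : realType) (S1 S2 W W3 X1 X2 X3 Y Y3 : finType)
    (p : fdist R (S1 * S2 * W * W3)) (ch : marc_channel R X1 X2 X3 Y Y3)
    (kappa : R) : achievable p ch kappa -> forall e, 0 < e ->
  exists (m n : nat) (c : code S1 S2 W W3 X1 X2 X3 Y Y3 m n),
  [/\ (0 < m)%N, n%:R <= kappa * m%:R & fano_bound p ch c <= e * m%:R].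
Proof.
move=> hk e e0.
pose L : R := ln (#|S1|%:R * #|S2|%:R).
have L0 : 0 <= L.
  rewrite ln_ge0// -natrM ler1n muln_gt0.
  by have := fdist_card_gt0 p; rewrite !card_prod !muln_gt0 => /andP[/andP[]].
(* This threshold holds the error term to half of [e * m], as L / (L + 1) <= 1; [L + 1] is positive
   even for one-letter sources. The bound [b] below makes [m] large enough for [ln 2] to fit in the
   other half. *)
have d0 : 0 < e / (2 * (L + 1)) by rewrite divr_gt0// mulr_gt0// ltr_wpDl.
have [m0 hm] := hk _ d0.
pose b := Num.bound (2 * ln 2 / e).
have [n [nk [c hc]]] := hm (maxn m0 b).+1 (leq_maxl _ _).
exists (maxn m0 b).+1, n, c; set m := (maxn m0 b).+1; split => //.
  have : (n%:Z)%:~R = n%:R :> R by [].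
  by rewrite nk => <-; rewrite floor_le.
have m0' : 0 < m%:R :> R by rewrite ltr0n.
have mb : 2 * ln 2 / e <= m%:R.
  apply: le_trans (ltW (archi_boundP _)) _.
    by rewrite divr_ge0 ?mulr_ge0 ?ln_ge0 ?(ltW e0)// ler1n.
  by rewrite ler_nat -/b /m leqW// leq_maxr.
have h1 : ln 2 <= e / 2 * m%:R.
  by move: mb; rewrite ler_pdivrMr//; lra.
rewrite /fano_bound -/L.
have h2 : error_prob p ch c * (m%:R * L) <= e / (2 * (L + 1)) * (m%:R * L).
  by rewrite ler_wpM2r// ?mulr_ge0// ltW.
have h3 : e / (2 * (L + 1)) * (m%:R * L) <= e / 2 * m%:R.
  have -> : e / (2 * (L + 1)) * (m%:R * L) = (e / 2 * m%:R) * (L / (L + 1)).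
    by field; lra.
  rewrite -[leRHS]mulr1 ler_wpM2l//; first by rewrite mulr_ge0// divr_ge0// ltW.
  by rewrite ler_pdivrMr ?mul1r; lra.
lra.
Qed.

(** Nonnegativity of [I] allows [n], the rounded-down block length, to be replaced by [kappa * m]
    before dividing by [m]. *)
Lemma per_letter_bound (R : realType) (kappa e H I b : R) (m n : nat) :
  (0 < m)%N -> n%:R <= kappa * m%:R -> b <= e * m%:R -> 0 <= I ->
  m%:R * H <= b + n%:R * I -> H <= kappa * I + e.
Proof.
move=> m0 nk be I0 h; have mR : 0 < m%:R :> R by rewrite ltr0n.
rewrite -(ler_pM2l mR) (le_trans h)//.
have := ler_wpM2r I0 nk; lra.
Qed.

Theorem theorem2 (R : realType) (S1 S2 W W3 X1 X2 X3 Y Y3 : finType)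
    (hX1 : (0 < #|X1|)%N) (hX2 : (0 < #|X2|)%N) (hX3 : (0 < #|X3|)%N)
    (p : fdist R (S1 * S2 * W * W3)) (ch : marc_channel R X1 X2 X3 Y Y3)
    (kappa : R) (hkappa : achievable p ch kappa) :
  (exists P : fdist R (X1 * X2 * X3),
    let q := law_X P ch in
    [/\ cond_entropy p (fun '(s1, s2, w, w3) => s1)
                       (fun '(s1, s2, w, w3) => (s2, w))
        <= kappa * cond_mutual_info q (fun '(x1, x2, x3, y, y3) => (x1, x3))
                                      (fun '(x1, x2, x3, y, y3) => y)
                                      (fun '(x1, x2, x3, y, y3) => x2),
        cond_entropy p (fun '(s1, s2, w, w3) => s2)
                       (fun '(s1, s2, w, w3) => (s1, w))
        <= kappa * cond_mutual_info q (fun '(x1, x2, x3, y, y3) => (x2, x3))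
                                      (fun '(x1, x2, x3, y, y3) => y)
                                      (fun '(x1, x2, x3, y, y3) => x1)
      & cond_entropy p (fun '(s1, s2, w, w3) => (s1, s2))
                       (fun '(s1, s2, w, w3) => w)
        <= kappa * mutual_info q (fun '(x1, x2, x3, y, y3) => (x1, x2, x3))
                                 (fun '(x1, x2, x3, y, y3) => y)]) /\
  (exists (V : finType) (PV : fdist R V) (P12 : V -> fdist R (X1 * X2))
          (P3 : V -> fdist R X3),
    let q := law_VX PV P12 P3 ch in
    (#|V| <= 4)%N /\
    [/\ cond_entropy p (fun '(s1, s2, w, w3) => s1)
                       (fun '(s1, s2, w, w3) => (s2, w, w3))
        <= kappa * cond_mutual_info q (fun '(v, x1, x2, x3, y, y3) => x1)
                                      (fun '(v, x1, x2, x3, y, y3) => (y, y3))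
                                      (fun '(v, x1, x2, x3, y, y3) => (x2, v)),
        cond_entropy p (fun '(s1, s2, w, w3) => s2)
                       (fun '(s1, s2, w, w3) => (s1, w, w3))
        <= kappa * cond_mutual_info q (fun '(v, x1, x2, x3, y, y3) => x2)
                                      (fun '(v, x1, x2, x3, y, y3) => (y, y3))
                                      (fun '(v, x1, x2, x3, y, y3) => (x1, v))
      & cond_entropy p (fun '(s1, s2, w, w3) => (s1, s2))
                       (fun '(s1, s2, w, w3) => (w, w3))
        <= kappa * cond_mutual_info q (fun '(v, x1, x2, x3, y, y3) => (x1, x2))
                                      (fun '(v, x1, x2, x3, y, y3) => (y, y3))
                                      (fun '(v, x1, x2, x3, y, y3) => v)]).
Proof.
have [x1_0 _] := card_gt0P hX1.
have [x2_0 _] := card_gt0P hX2.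
have [x3_0 _] := card_gt0P hX3.
have B0 : (0 < #|{: Y * Y3}|)%N := fdist_card_gt0 (ch x1_0 x2_0 x3_0).
have approx := achievable_approx hkappa.
split.
- suff : exists P : fdist R (X1 * X2 * X3), let q := law_X P ch in
    [/\ cond_entropy p (fun '(s1, s2, w, w3) => s1) (fun '(s1, s2, w, w3) => (s2, w))
        <= kappa * cond_mutual_info q (fun '(x1, x2, x3, y, y3) => (x1, x3))
          (fun '(x1, x2, x3, y, y3) => y) (fun '(x1, x2, x3, y, y3) => x2),
        cond_entropy p (fun '(s1, s2, w, w3) => s2) (fun '(s1, s2, w, w3) => (s1, w))
        <= kappa * cond_mutual_info q (fun '(x1, x2, x3, y, y3) => (x2, x3))
          (fun '(x1, x2, x3, y, y3) => y) (fun '(x1, x2, x3, y, y3) => x1)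
      & cond_entropy p (fun '(s1, s2, w, w3) => (s1, s2)) (fun '(s1, s2, w, w3) => w)
        <= kappa * cond_mutual_info q (fun '(x1, x2, x3, y, y3) => (x1, x2, x3))
          (fun '(x1, x2, x3, y, y3) => y) (fun=> tt)].
    move=> [P [h1 h2 h3]]; exists P; split=> //.
    by rewrite mutual_info_unit//; [exact: law_X_ge0 | exact: sum_law_X].
  apply: limit_law_X => e e0; have [m [n [c [m0 nk be]]]] := approx e e0.
  (* Without channel uses every input law satisfies the approximate bounds, so a point mass is
     taken. *)
  have [n0|n0] := posnP n.
    exists (dirac R (x1_0, x2_0, x3_0)).
    have q0 := law_X_ge0 ch (dirac R (x1_0, x2_0, x3_0)).
    have I0 := fun A B C X Y Z => @cond_mutual_info_ge0 _ _ _ A B C X Y Z q0.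
    split; apply: (per_letter_bound m0 nk be (I0 _ _ _ _ _ _));
      apply: no_channel_use => //;
      by move=> [[[? ?] ?] ?] [[[? ?] ?] ?] /=; rewrite /src1 /src2 /side/=; congruence.
  have [P [h1 h2 h3]] := cut_set_i p ch c n0 B0; exists P.
  have q0 := law_X_ge0 ch P.
  rewrite mutual_info_unit// in h3; last exact: sum_law_X.
  by split; [apply: (per_letter_bound m0 nk be _ h1) | apply: (per_letter_bound m0 nk be _ h2)
    | apply: (per_letter_bound m0 nk be _ h3)]; exact: cond_mutual_info_ge0.
- suff [PV [P12 [P3 h]]] : exists (PV : fdist R 'I_4) (P12 : 'I_4 -> fdist R (X1 * X2))
      (P3 : 'I_4 -> fdist R X3), let q := law_VX PV P12 P3 ch in
    [/\ cond_entropy p (fun '(s1, s2, w, w3) => s1) (fun '(s1, s2, w, w3) => (s2, w, w3))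
        <= kappa * cond_mutual_info q (fun '(v, x1, x2, x3, y, y3) => x1)
          (fun '(v, x1, x2, x3, y, y3) => (y, y3)) (fun '(v, x1, x2, x3, y, y3) => (x2, v)),
        cond_entropy p (fun '(s1, s2, w, w3) => s2) (fun '(s1, s2, w, w3) => (s1, w, w3))
        <= kappa * cond_mutual_info q (fun '(v, x1, x2, x3, y, y3) => x2)
          (fun '(v, x1, x2, x3, y, y3) => (y, y3)) (fun '(v, x1, x2, x3, y, y3) => (x1, v))
      & cond_entropy p (fun '(s1, s2, w, w3) => (s1, s2)) (fun '(s1, s2, w, w3) => (w, w3))
        <= kappa * cond_mutual_info q (fun '(v, x1, x2, x3, y, y3) => (x1, x2))
          (fun '(v, x1, x2, x3, y, y3) => (y, y3)) (fun '(v, x1, x2, x3, y, y3) => v)].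
    by exists 'I_4, PV, P12, P3; rewrite card_ord.
  apply: limit_law_VX => e e0; have [m [n [c [m0 nk be]]]] := approx e e0.
  have [n0|n0] := posnP n.
    exists (dirac R ord0), (fun=> dirac R (x1_0, x2_0)), (fun=> dirac R x3_0).
    have q0 := law_VX_ge0 ch (dirac R (ord0 : 'I_4))
      (fun=> dirac R (x1_0, x2_0)) (fun=> dirac R x3_0).
    have I0 := fun A B C X Y Z => @cond_mutual_info_ge0 _ _ _ A B C X Y Z q0.
    split; apply: (per_letter_bound m0 nk be (I0 _ _ _ _ _ _));
      apply: no_channel_use => //;
      by move=> [[[? ?] ?] ?] [[[? ?] ?] ?] /=; rewrite /src1 /src2 /side/=; congruence.
  have [V [PV [P12 [P3]]]] := cut_set_ii p ch c n0 B0 x1_0 x2_0 x3_0.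
  have [QV [Q12 [Q3 /= [<- <- <-]]]] := time_sharing_cardinality ch PV P12 P3.
  move=> [h1 h2 h3]; exists QV, Q12, Q3; have q0 := law_VX_ge0 ch QV Q12 Q3.
  by split; [apply: (per_letter_bound m0 nk be _ h1) | apply: (per_letter_bound m0 nk be _ h2)
    | apply: (per_letter_bound m0 nk be _ h3)]; exact: cond_mutual_info_ge0.
Qed.
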